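(* Let $p$ be a prime and $r\in\mathbb N_{>1}$. Let $k_1,\ldots,k_r\in\mathbb Z$ with $k_1+\cdots+k_r\not\equiv r\pmod2$, $\gamma_1\in\mathbb Z_p$, $\gamma_2,\ldots,\gamma_r\in p\mathbb Z_p$ and $c\in\mathbb Z_p^\times$. Then for all $s_1,\ldots,s_r\in\mathbb Z_p$, \begin{align*} &L_{p,r}(s_1,\ldots,s_r;\omega^{k_1},\ldots,\omega^{k_r};\gamma_1,\gamma_2,\ldots,\gamma_r;c)\\ &=-\sum_{\substack{J\subsetneq\{1,\ldots,r\}\\ 1\in J}}\Bigl(\frac{1-c}2\Bigr)^{r-|J|}L_{p,|J|}\Bigl(\Bigl(\sum_{j_\mu(J)\le l<j_{\mu+1}(J)}s_l\Bigr)_{\mu=1}^{|J|};\bigl(\omega^{\sum_{j_\mu(J)\le l<j_{\mu+1}(J)}k_l}\bigr)_{\mu=1}^{|J|};(\gamma_j)_{j\in J};c\Bigr), \end{align*} where for $J\subset\{1,\ldots,r\}$ with $1\in J$ one writes $J=\{j_1(J),\ldots,j_{|J|}(J)\}$ with $1=j_1(J)<\cdots<j_{|J|}(J)$ and sets $j_{|J|+1}(J)=r+1$.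
   Context: Put $q=4$ if $p=2$ and $q=p$ if $p\ge3$. Let $W=\{\pm1\}$ if $p=2$ and $W=\{\xi\in\mathbb Z_p^\times:\xi^{p-1}=1\}$ if $p\ge3$. Write $x=\omega(x)\langle x\rangle$ for the decomposition $\mathbb Z_p^\times=W\times(1+q\mathbb Z_p)$, $\omega^k(x)=\omega(x)^k$, and $\langle x\rangle^s=\sum_{n\ge0}\binom sn(\langle x\rangle-1)^n$ for $s\in\mathbb C_p$, $|s|_p<qp^{-1/(p-1)}$. For $c\in\mathbb Z_p^\times$ let $g_c(T)=\frac1{(1+T)-1}-\frac c{(1+T)^c-1}\in\mathbb Z_p[[T]]$, and let $\widetilde{\mathfrak m}_c$ be the $\mathbb Z_p$-valued measure on $\mathbb Z_p$ corresponding to $g_c(T)$ under the identification $\mathrm{Meas}_{\mathbb Z_p}(\mathbb Z_p)\simeq\mathbb Z_p[[\mathbb Z_p]]\simeq\mathbb Z_p[[T]]$ sending $1\in\mathbb Z_p$ (as group element) to $1+T$; that is, $\int_{\mathbb Z_p}(1+T)^x\,d\widetilde{\mathfrak m}_c(x)=g_c(T)$. (For an integer $c>1$ prime to $p$ it is the measure with $\widetilde{\mathfrak m}_c(j+p^N\mathbb Z_p)=\sum_{\xi^c=1,\xi\ne1}\frac{\xi^j}{1-\xi^{p^N}}$, $0\le j<p^N$.) For $r\in\mathbb N$, $k_j\in\mathbb Z$, $\gamma_j\in\mathbb Z_p$, $c\in\mathbb Z_p^\times$ and $s_j\in\mathbb C_p$ with $|s_j|_p<qp^{-1/(p-1)}$,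 the $p$-adic multiple $L$-function of depth $r$ is $$L_{p,r}(s_1,\ldots,s_r;\omega^{k_1},\ldots,\omega^{k_r};\gamma_1,\ldots,\gamma_r;c)=\int_{(\mathbb Z_p^r)'_{\{\gamma_j\}}}\prod_{k=1}^r\Bigl\langle\sum_{j=1}^kx_j\gamma_j\Bigr\rangle^{-s_k}\omega^{k_k}\Bigl(\sum_{j=1}^kx_j\gamma_j\Bigr)\prod_{j=1}^rd\widetilde{\mathfrak m}_c(x_j),$$ where $(\mathbb Z_p^r)'_{\{\gamma_j\}}=\{(x_j)\in\mathbb Z_p^r:p\nmid\sum_{j=1}^kx_j\gamma_j\text{ for all }1\le k\le r\}$; it is interpreted as $0$ when this set is empty (e.g. when $\gamma_1\in p\mathbb Z_p$). *)

(* Defs.v *)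
From HB Require Import structures.
From mathcomp Require Import all_boot all_order all_algebra.
From mathcomp Require Import all_classical.
From mathcomp Require Import topology sequences.

Set Implicit Arguments.
Unset Strict Implicit.
Unset Printing Implicit Defensive.

Import GRing.Theory.

Local Open Scope classical_set_scope.
Local Open Scope ring_scope.

(* The inverse limit of the Z/p^n: [residue x n] is the representative of x modulo
   p^n with [0 <= residue x n < p^n]; the bound is a consequence of the coherence
   condition. *)
Record padicZ (p : nat) (pr : prime p) := PadicZ {
  residue : nat -> nat;
  res_coherent : forall n, (residue n.+1 %% p ^ n)%N = residue n }.

Section PadicIntegers.
Variables (p : nat) (pr : prime p).
Local Notation Zp := (padicZ pr).
Implicit Types x y z : Zp.

Lemma expp_gt0 n : (0 < p ^ n)%N.
Proof. by rewrite expn_gt0 prime_gt0. Qed.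

Lemma res_lt x n : (residue x n < p ^ n)%N.
Proof. by rewrite -res_coherent ltn_mod expp_gt0. Qed.

Lemma res_mod x n : (residue x n %% p ^ n)%N = residue x n.
Proof. exact/modn_small/res_lt. Qed.

Lemma res_le x m n : (m <= n)%N -> (residue x n %% p ^ m)%N = residue x m.
Proof.
elim: n => [|n IH]; first by rewrite leqn0 => /eqP ->; rewrite res_mod.
rewrite leq_eqVlt => /predU1P[->|]; first exact: res_mod.
rewrite ltnS => mn; rewrite -[in RHS]IH // -(res_coherent x n).
by rewrite modn_dvdm // dvdn_exp2l.
Qed.

Lemma Zp_ext x y : (forall n, residue x n = residue y n %[mod p ^ n]) -> x = y.
Proof.
move=> e; have {}e : residue x = residue y.
  by apply/funext => n; rewrite -res_mod e res_mod.
case: x y e => [f fP] [g gP] /= e; move: gP; rewrite -e => gP.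
by congr (@PadicZ p pr _ _); exact: Prop_irrelevance.
Qed.

Fact Zp_of_subproof (f : nat -> nat) (fP : forall n, f n.+1 = f n %[mod p ^ n]) n :
  ((f n.+1 %% p ^ n.+1) %% p ^ n)%N = (f n %% p ^ n)%N.
Proof. by rewrite modn_dvdm ?dvdn_exp2l // fP. Qed.

Definition Zp_of f fP : Zp := @PadicZ p pr _ (@Zp_of_subproof f fP).

Lemma res_S x n : residue x n.+1 = residue x n %[mod p ^ n].
Proof. by rewrite res_coherent res_mod. Qed.

Fact natZp_subproof m n : m = m %[mod p ^ n]. Proof. by []. Qed.
Definition natZp m := @Zp_of (fun=> m) (natZp_subproof m).

Fact addZp_subproof x y n :
  (residue x n.+1 + residue y n.+1 = residue x n + residue y n %[mod p ^ n])%N.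
Proof. by rewrite -modnDm !res_S modnDm. Qed.
Definition addZp x y := Zp_of (addZp_subproof x y).

Fact mulZp_subproof x y n :
  (residue x n.+1 * residue y n.+1 = residue x n * residue y n %[mod p ^ n])%N.
Proof. by rewrite -modnMm !res_S modnMm. Qed.
Definition mulZp x y := Zp_of (mulZp_subproof x y).

Fact oppZp_subproof x n :
  (p ^ n.+1 - residue x n.+1 = p ^ n - residue x n %[mod p ^ n])%N.
Proof.
apply/eqP; rewrite -(eqn_modDr (residue x n)) subnK; last exact/ltnW/res_lt.
rewrite -modnDmr -res_S modnDmr subnK; last exact/ltnW/res_lt.
by rewrite modnn; apply/dvdn_exp2l.
Qed.
Definition oppZp x := Zp_of (oppZp_subproof x).

HB.instance Definition _ := gen_eqMixin Zp.
HB.instance Definition _ := gen_choiceMixin Zp.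

Fact addZpA : associative addZp.
Proof.
by move=> x y z; apply: Zp_ext => n /=; rewrite !modn_mod modnDml modnDmr addnA.
Qed.
Fact addZpC : commutative addZp.
Proof. by move=> x y; apply: Zp_ext => n /=; rewrite addnC. Qed.
Fact add0Zp : left_id (natZp 0) addZp.
Proof. by move=> x; apply: Zp_ext => n /=; rewrite mod0n add0n modn_mod. Qed.
Fact addNZp : left_inverse (natZp 0) oppZp addZp.
Proof.
move=> x; apply: Zp_ext => n /=; rewrite modn_mod modnDml subnK ?modnn ?mod0n //.
exact/ltnW/res_lt.
Qed.

HB.instance Definition _ :=
  GRing.isZmodule.Build Zp addZpA addZpC add0Zp addNZp.

Fact mulZpA : associative mulZp.
Proof.
by move=> x y z; apply: Zp_ext => n /=; rewrite !modn_mod modnMml modnMmr mulnA.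
Qed.
Fact mulZpC : commutative mulZp.
Proof. by move=> x y; apply: Zp_ext => n /=; rewrite mulnC. Qed.
Fact mul1Zp : left_id (natZp 1) mulZp.
Proof. by move=> x; apply: Zp_ext => n /=; rewrite modn_mod modnMml mul1n. Qed.
Fact mulZpDl : left_distributive mulZp +%R.
Proof.
move=> x y z; apply: Zp_ext => n /=.
by rewrite !modn_mod modnMml modnDm mulnDl.
Qed.
Fact oneZp_neq0 : natZp 1 != 0.
Proof.
apply/eqP => /(congr1 (fun x => residue x 1)) /=.
by rewrite expn1 mod0n modn_small ?prime_gt1.
Qed.

HB.instance Definition _ :=
  GRing.Zmodule_isComNzRing.Build Zp mulZpA mulZpC mul1Zp mulZpDl oneZp_neq0.

Definition unitZp : {pred Zp} := fun x => `[< exists y, y * x = 1 >].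
Definition invZp x := if x \in unitZp then xget 0 [set y | y * x = 1] else x.

Fact mulVZp : {in unitZp, left_inverse 1 invZp *%R}.
Proof.
move=> x ux; rewrite /invZp ux; have /asboolP[y yx] := ux.
by case: xgetP => [z _ //|/(_ y)].
Qed.
Fact unitZpPl x y : y * x = 1 -> unitZp x.
Proof. by move=> yx; apply/asboolP; exists y. Qed.
Fact invZp_out : {in [predC unitZp], invZp =1 id}.
Proof. by move=> x; rewrite inE /invZp => /negbTE ->. Qed.

HB.instance Definition _ :=
  GRing.ComNzRing_hasMulInverse.Build Zp mulVZp unitZpPl invZp_out.

Lemma Zp_neq0 x : x != 0 -> exists n, ~~ (p ^ n %| residue x n)%N.
Proof.
apply: contra_neqP => /forallNP e; apply: Zp_ext => n /=.
by rewrite mod0n mod0n; apply/eqP/negPn/negP/e.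
Qed.

Fact Zp_idomain : GRing.integral_domain_axiom Zp.
Proof.
move=> x y xy0; apply/negPn/negP; rewrite negb_or => /andP[].
move=> /Zp_neq0[m xm] /Zp_neq0[n yn].
have {}xm : ~~ (p ^ m %| residue x (m + n))%N.
  by apply: contra xm; rewrite /dvdn res_le ?leq_addr // res_mod.
have {}yn : ~~ (p ^ n %| residue y (m + n))%N.
  by apply: contra yn; rewrite /dvdn res_le ?leq_addl // res_mod.
have x0 : (0 < residue x (m + n))%N by case: (residue x _) xm => //; rewrite dvdn0.
have y0 : (0 < residue y (m + n))%N by case: (residue y _) yn => //; rewrite dvdn0.
have : (p ^ (m + n) %| residue x (m + n) * residue y (m + n))%N.
  have /(congr1 (fun z => residue z (m + n))) /= := xy0.
  by rewrite /dvdn mod0n => ->.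
move: xm yn; rewrite !pfactor_dvdn ?muln_gt0 ?x0 // lognM // -!ltnNge.
by move=> xm yn; rewrite leqNgt -addSn leq_add // ltnW.
Qed.

HB.instance Definition _ :=
  GRing.ComUnitRing_isIntegral.Build Zp Zp_idomain.

(* [ballZp x n] is x + p^n Z_p. *)
Definition ballZp x n : set Zp := [set y | residue y n = residue x n].

HB.instance Definition _ := isPointed.Build Zp 0.
HB.instance Definition _ :=
  hasNbhs.Build Zp (fun x => filter_from setT (ballZp x)).

Fact nbhsZp_filter x : ProperFilter (nbhs x).
Proof.
apply: filter_from_proper; last by move=> n _; exists x.
apply: filter_from_filter; first by exists 0%N.
move=> m n _ _; exists (maxn m n) => // y; rewrite /ballZp /= => e; split.
  by rewrite -(res_le y (leq_maxl m n)) -(res_le x (leq_maxl m n)) e.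
by rewrite -(res_le y (leq_maxr m n)) -(res_le x (leq_maxr m n)) e.
Qed.
Fact nbhsZp_singleton x (A : set Zp) : nbhs x A -> A x.
Proof. by case=> n _; apply; rewrite /ballZp. Qed.
Fact nbhsZp_nbhs x (A : set Zp) : nbhs x A -> nbhs x (nbhs^~ A).
Proof.
case=> n _ xA; exists n => // y /= e; exists n => // z; rewrite /ballZp /= => e'.
by apply: xA; rewrite /ballZp /= e' e.
Qed.

HB.instance Definition _ := Nbhs_isNbhsTopological.Build Zp
  nbhsZp_filter nbhsZp_singleton nbhsZp_nbhs.

End PadicIntegers.

Notation Qp pr := {fraction (padicZ pr)}.
Notation "x %:Qp" := (@FracField.tofrac _ x)
  (at level 2, left associativity, format "x %:Qp") : ring_scope.

Section Theory.
Variables (p : nat) (pr : prime p).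
Local Notation Zp := (padicZ pr).

Definition inpZp (x : Zp) : Prop := exists y, x = p%:R * y.

Definition qp : nat := if p == 2 then 4 else p.

Definition inW (w : Zp) : Prop :=
  if p == 2 then w = 1 \/ w = -1 else w ^+ p.-1 = 1.

(* For [x] not a unit this is a junk value. *)
Definition omega (x : Zp) : Zp :=
  xget 1 [set w | inW w /\ exists y, x = w * (1 + qp%:R * y)].

Definition angle (x : Zp) : Zp := x / omega x.

(* binom(s,n) = s(s-1)...(s-n+1)/n!, which is an element of Z_p; the equation
   determines it because Z_p is a domain of characteristic zero. *)
Definition binomZp (s : Zp) (n : nat) : Zp :=
  xget 0 [set b | b * n`!%:R = \prod_(i < n) (s - i%:R)].

Definition powZp (u s : Zp) : Zp :=
  lim (series (fun n => binomZp s n * (u - 1) ^+ n) @ \oo).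

(* A measure m is given by its values [mass m N a] = m(a + p^N Z_p) on balls,
   that is, as an element of Z_p[[Z_p]] = lim Z_p[Z/p^N]. *)
Record measureZp := MeasureZp {
  mass : forall N, 'I_(p ^ N) -> Zp;
  mass_additive : forall N (a : 'I_(p ^ N)),
    mass a = \sum_(b < p ^ N.+1 | (b %% p ^ N)%N == a) mass b }.

HB.instance Definition _ := gen_eqMixin measureZp.
HB.instance Definition _ := gen_choiceMixin measureZp.

Fact measureZp0_subproof N (a : 'I_(p ^ N)) :
  0 = \sum_(b < p ^ N.+1 | (b %% p ^ N)%N == a) (0 : Zp).
Proof. by rewrite big1. Qed.
Definition measureZp0 := @MeasureZp (fun _ _ => 0) measureZp0_subproof.

(* The integral over Z_p^r against the r-fold product of m, as the limit of
   Riemann sums over the cosets of (p^N Z_p)^r. *)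
Definition integralZp (r : nat) (m : measureZp) (f : ('I_r -> Zp) -> Zp) : Zp :=
  lim ((fun N => \sum_(a : {ffun 'I_r -> 'I_(p ^ N)})
                   f (fun j => (a j : nat)%:R) * \prod_j mass m (a j)) @ \oo).

(* Power series over Z_p are represented by their coefficient sequences. *)
Definition pseries := nat -> Zp.
Definition mulps (f g : pseries) : pseries :=
  fun n => \sum_(i < n.+1) f i * g (n - i)%N.
Definition Tps : pseries := fun n => (n == 1%N)%:R.
(* (1 + T)^x - 1 *)
Definition powps1 (x : Zp) : pseries := fun n => if n == 0%N then 0 else binomZp x n.

(* g_c(T) = 1/((1+T)-1) - c/((1+T)^c-1), denominators being cleared;
   Z_p[[T]] is a domain, so this determines g_c when c is a unit. *)
Definition gc (c : Zp) : pseries :=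
  xget (fun=> 0)
    [set g | mulps g (mulps Tps (powps1 c)) = fun n => powps1 c n - c * Tps n].

(* m corresponds to g when \int (1+T)^x dm(x) = g(T), coefficientwise. *)
Definition corresponds (m : measureZp) (g : pseries) : Prop :=
  forall n, integralZp m (fun x : 'I_1 -> Zp => binomZp (x ord0) n) = g n.

Definition mtilde (c : Zp) : measureZp :=
  xget measureZp0 [set m | corresponds m (gc c)].

Definition psum (r : nat) (gamma x : 'I_r -> Zp) (k : 'I_r) : Zp :=
  \sum_(j < r | (j <= k)%N) x j * gamma j.

Definition Ldomain (r : nat) (gamma : 'I_r -> Zp) : set ('I_r -> Zp) :=
  [set x | forall k, ~ inpZp (psum gamma x k)].

(* Indices run over 0, ..., r-1 instead of 1, ..., r. *)
Definition Lp (r : nat) (s : 'I_r -> Zp) (k : 'I_r -> int) (gamma : 'I_r -> Zp)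
    (c : Zp) : Zp :=
  integralZp (mtilde c)
    (patch (fun=> 0) (Ldomain gamma)
       (fun x => \prod_(i < r)
          (powZp (angle (psum gamma x i)) (- s i) * omega (psum gamma x i) ^ k i))).

End Theory.

(* The (mu+1)-st element of J, or r when mu >= #|J|. *)
Definition jelt (r : nat) (J : {set 'I_r}) (mu : nat) : nat :=
  nth r [seq nat_of_ord j | j <- enum J] mu.

Definition inblock (r : nat) (J : {set 'I_r}) (mu : nat) (l : 'I_r) : bool :=
  (jelt J mu <= l < jelt J mu.+1)%N.

(* Main.v *)
(* Let m be the measure of [g_c]. Clearing denominators, the equation defining [g_c]
   says that m convolved with ([1]-[0])*([c]-[0]) is ([c]-[0]) - c([1]-[0]). Reflecting
   x to -x in this identity and adding shows that the same convolution kills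
   m(x) + m(-x) - (c-1) delta_0, which therefore vanishes, because no nonzero bounded
   p-adic distribution is translation invariant. So m' = 2m + (1-c) delta_0 is an odd
   measure. The integrand f of the L-function satisfies f(-x) = (-1)^(k_1+...+k_r) f(x),
   hence its integral against the r-fold product of m' vanishes by the parity
   hypothesis. Expanding the product over the set J of coordinates that carry m gives
   the relation: when the coordinates outside J are 0, the partial sums are constant on
   the blocks of J, so that f becomes the integrand attached to J, and f = 0 if J does
   not contain the first index. *)
From HB Require Import structures.
Require Import Defs.
From mathcomp Require Import all_boot all_order all_algebra.
From mathcomp Require Import all_classical.
From mathcomp Require Import cyclic topology sequences.
From mathcomp Require Import zify ring.

Set Implicit Arguments.
Unset Strict Implicit.
Unset Printing Implicit Defensive.

Import GRing.Theory.

Local Open Scope ring_scope.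

(** * Congruences *)

Section Congruences.
Variables (p : nat) (pr : prime p).
Local Notation Zp := (padicZ pr).
Implicit Types (x y z : Zp) (n : nat).

(** Limits, continuity and Cauchy conditions are all phrased through congruence modulo [p ^ n], that
    is, through the basic neighbourhoods. *)
Definition cong n x y := residue x n = residue y n.

Lemma congxx n x : cong n x x. Proof. by []. Qed.

Lemma cong_sym n x y : cong n x y -> cong n y x. Proof. by []. Qed.

Lemma cong_trans n x y z : cong n x y -> cong n y z -> cong n x z.
Proof. exact: etrans. Qed.

Lemma cong0 x y : cong 0 x y.
Proof.
rewrite /cong; have := res_lt x 0; have := res_lt y 0.
by rewrite !expn0 !ltnS !leqn0 => /eqP-> /eqP->.
Qed.

Lemma congW m n x y : (m <= n)%N -> cong n x y -> cong m x y.
Proof. by move=> mn e; rewrite /cong -(res_le x mn) e res_le. Qed.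

Lemma cong_eq x y : (forall n, cong n x y) -> x = y.
Proof. by move=> e; apply: Zp_ext => n; rewrite e. Qed.

Lemma resD x y n : residue (x + y) n = ((residue x n + residue y n) %% p ^ n)%N.
Proof. by []. Qed.

Lemma resM x y n : residue (x * y) n = ((residue x n * residue y n) %% p ^ n)%N.
Proof. by []. Qed.

Lemma resN x n : residue (- x) n = ((p ^ n - residue x n) %% p ^ n)%N.
Proof. by []. Qed.

Lemma res_nat m n : residue (m%:R : Zp) n = (m %% p ^ n)%N.
Proof.
by elim: m => [|m IH] //; rewrite -natr1 resD IH /= modnDm addn1.
Qed.

Lemma congD n x y x' y' : cong n x x' -> cong n y y' -> cong n (x + y) (x' + y').
Proof. by rewrite /cong !resD => -> ->. Qed.

Lemma congM n x y x' y' : cong n x x' -> cong n y y' -> cong n (x * y) (x' * y').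
Proof. by rewrite /cong !resM => -> ->. Qed.

Lemma congN n x x' : cong n x x' -> cong n (- x) (- x').
Proof. by rewrite /cong !resN => ->. Qed.

Lemma congB n x y x' y' : cong n x x' -> cong n y y' -> cong n (x - y) (x' - y').
Proof. by move=> ex ey; apply/congD/congN. Qed.

Lemma congX n x x' m : cong n x x' -> cong n (x ^+ m) (x' ^+ m).
Proof. by move=> e; elim: m => // m IH; rewrite !exprS; apply: congM. Qed.

Lemma cong_sum n I (r : seq I) (P : pred I) (F G : I -> Zp) :
  (forall i, P i -> cong n (F i) (G i)) ->
  cong n (\sum_(i <- r | P i) F i) (\sum_(i <- r | P i) G i).
Proof. by move=> e; elim/big_ind2: _ => // *; apply: congD. Qed.

Lemma cong_prod n I (r : seq I) (P : pred I) (F G : I -> Zp) :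
  (forall i, P i -> cong n (F i) (G i)) ->
  cong n (\prod_(i <- r | P i) F i) (\prod_(i <- r | P i) G i).
Proof. by move=> e; elim/big_ind2: _ => // *; apply: congM. Qed.

Lemma cong_residue n x : cong n x (residue x n)%:R.
Proof. by rewrite /cong res_nat res_mod. Qed.

Lemma cong_mod n m : cong n m%:R (m %% p ^ n)%N%:R.
Proof. by rewrite /cong !res_nat modn_mod. Qed.

Lemma cong_pX n x : cong n (p%:R ^+ n * x) 0.
Proof.
rewrite -(mul0r x); apply: congM => //.
by rewrite /cong -natrX -[0]/(0%:R) !res_nat modnn mod0n.
Qed.

(** Coherence for the quotient of [x] by [p ^ n]: its residue at level [m] comes from the residue of
    [x] at level [n + m], divided by [p ^ n]. *)
Fact shift_subproof n x (e : cong n x 0) m :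
  (residue x (n + m.+1) %/ p ^ n = residue x (n + m) %/ p ^ n %[mod p ^ m])%N.
Proof.
have pn0 := expp_gt0 pr n.
have -> : residue x (n + m) = (residue x (n + m.+1) %% p ^ (n + m))%N.
  by rewrite res_le // leq_add2l.
rewrite {1}(divn_eq (residue x (n + m.+1)) (p ^ (n + m))).
set q := (_ %/ p ^ (n + m))%N; rewrite expnD.
have -> : (q * (p ^ n * p ^ m) = q * p ^ m * p ^ n)%N.
  by rewrite -mulnA [(p ^ n * _)%N]mulnC.
by rewrite divnMDl // modnMDl.
Qed.

Lemma cong0P n x : cong n x 0 <-> exists y, x = p%:R ^+ n * y.
Proof.
split=> [e|[y ->]]; last exact: cong_pX.
exists (Zp_of pr (shift_subproof e)); apply: Zp_ext => m.
have pn0 := expp_gt0 pr n.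
rewrite -natrX resM res_nat /= modnMml.
rewrite modn_mod -(res_le x (leq_addl n m)).
have d : (p ^ n %| residue x (n + m))%N.
  rewrite /dvdn res_le ?leq_addr // e -[0]/(0%:R) res_nat mod0n //.
rewrite -{1}(divnK d) mulnC modn_mod.
by rewrite modnMmr.
Qed.

Lemma congP n x y : cong n x y <-> exists z, x = y + p%:R ^+ n * z.
Proof.
split=> [e|[z ->]].
  have /cong0P[z zE] : cong n (x - y) 0 by rewrite -(subrr y); apply: congB.
  by exists z; rewrite -zE addrC subrK.
by rewrite -[X in cong _ _ X]addr0; apply/congD/cong_pX.
Qed.

Lemma inpZpP x : inpZp x <-> cong 1 x 0.
Proof. by rewrite cong0P expr1. Qed.

Lemma cong_complete (u : nat -> Zp) :
  (forall n, cong n (u n.+1) (u n)) -> exists l, forall n, cong n (u n) l.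
Proof.
move=> e; have eP n : residue (u n.+1) n.+1 = residue (u n) n %[mod p ^ n].
  by rewrite -(e n) res_le // res_mod.
by exists (Zp_of pr eP) => n; rewrite /cong /= res_mod.
Qed.

Lemma padicZ_hausdorff : hausdorff_space Zp.
Proof.
move=> x y cl; apply: cong_eq => n.
have [] := cl (ballZp x n) (ballZp y n); [by exists n|by exists n|].
by move=> z [zx zy]; rewrite /cong -[LHS]zx -[RHS]zy.
Qed.

Lemma lim_cong (u : nat -> Zp) l :
  (forall n, exists K, forall k, (K <= k)%N -> cong n (u k) l) ->
  lim (u @ \oo)%classic = l.
Proof.
move=> e; apply: (@cvg_lim _ padicZ_hausdorff) => A [n _ An].
have [K KP] := e n; exists K => // k /= Kk; exact/An/KP.
Qed.

(** By the ultrametric inequality, comparing consecutive terms is enough for convergence. *)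
Lemma cauchy_cong (u : nat -> Zp) :
  (forall n, exists K, forall k, (K <= k)%N -> cong n (u k.+1) (u k)) ->
  forall n, exists K, forall k, (K <= k)%N -> cong n (u k) (lim (u @ \oo)%classic).
Proof.
move=> e.
have {}e n : exists K, forall k l, (K <= k)%N -> (K <= l)%N -> cong n (u k) (u l).
  have [K KP] := e n; have E i : cong n (u (K + i)%N) (u K).
    elim: i => [|i IH]; first by rewrite addn0.
    by apply: cong_trans IH; rewrite addnS; apply/KP/leq_addr.
  exists K => k l Kk Kl; rewrite -(subnKC Kk) -(subnKC Kl).
  by apply: cong_trans (E _) _; apply/cong_sym/E.
have [K KP] := choice e.
(* The running maximum places the indices of [v n] and [v n.+1] both beyond [K n]. *)
pose v n := u (\max_(i < n.+1) K i)%N.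
have Kmax n i : (i <= n)%N -> (K i <= \max_(j < n.+1) K j)%N.
  by rewrite -ltnS => ilt; exact: (leq_bigmax (Ordinal ilt)).
have [l lP] : exists l, forall n, cong n (v n) l.
  by apply: cong_complete => n; apply: KP; apply: Kmax.
suff -> : lim (u @ \oo)%classic = l.
  move=> n; exists (K n) => k Kk; apply: cong_trans (lP n).
  by apply: KP => //; apply: Kmax.
apply: lim_cong => n; exists (K n) => k Kk; apply: cong_trans (lP n).
by apply: KP => //; apply: Kmax.
Qed.

Lemma natZp_neq0 d : (0 < d)%N -> (d%:R : Zp) != 0.
Proof.
move=> d0; apply/eqP => /(congr1 (fun x : Zp => residue x d)).
rewrite -[0]/(0%:R) !res_nat mod0n modn_small; first by case: d d0.
exact/ltn_expl/prime_gt1.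
Qed.

Lemma mulIn d x y : (0 < d)%N -> d%:R * x = d%:R * y -> x = y.
Proof. by move=> d0; apply/mulfI/natZp_neq0. Qed.

Lemma euler_cong x n : ~ cong 1 x 0 -> cong n (x ^+ totient (p ^ n)) 1.
Proof.
move=> ux; apply: cong_trans (congX _ (cong_residue n x)) _.
rewrite -natrX /cong -[1]/(1%:R) !res_nat; apply: Euler_exp_totient.
case: n => [|n]; first by rewrite expn0 coprimen1.
rewrite coprime_pexpr // coprime_sym prime_coprime //; apply/negP => d.
apply: ux; rewrite /cong -(res_le x (isT : 0 < n.+1)%N) -[0]/(0%:R) res_nat.
by rewrite mod0n expn1; apply/eqP.
Qed.

(** By Euler's theorem [x ^+ (totient (p ^ n)).-1] inverts [x] modulo [p ^ n], and these approximate
    inverses converge. *)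
Lemma unitZpP x : x \is a GRing.unit <-> ~ cong 1 x 0.
Proof.
split=> [ux e|ux].
  have : cong 1 (x^-1 * x) (x^-1 * 0) by apply: congM.
  rewrite mulVr // mulr0 /cong -[1]/(1%:R) -[0]/(0%:R) !res_nat expn1.
  by rewrite mod0n modn_small ?prime_gt1.
pose u n := x ^+ (totient (p ^ n)).-1.
have uxE n : cong n (u n * x) 1.
  rewrite -exprSr prednK; first exact: euler_cong.
  by rewrite totient_gt0 expp_gt0.
have [|y yP] := @cong_complete u.
  (* Modulo [p ^ n] the factor [x] cancels against either of [u n] and [u n.+1]. *)
  move=> n; apply: (@cong_trans _ _ (u n.+1 * (u n * x))).
    by rewrite -{1}[u n.+1]mulr1; apply: congM => //; apply: cong_sym.
  rewrite mulrCA -[X in cong _ _ X]mulr1; apply: congM => //.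
  exact: (@congW n n.+1).
apply/unitrPr; exists y; apply: cong_eq => n; apply: cong_trans (uxE n).
by rewrite mulrC; apply: congM => //; apply: cong_sym.
Qed.

(** The part of [d] prime to [p] is a unit. *)
Lemma nat_dvd_pX d : (0 < d)%N -> exists v (e : Zp), p%:R ^+ v = d%:R * e.
Proof.
move=> d0; have [m cpm dE] := pfactor_coprime pr d0.
exists (logn p d), (m%:R^-1); rewrite {2}dE natrM natrX mulrAC divrr ?mul1r //.
apply/unitZpP; rewrite /cong -[0]/(0%:R) !res_nat mod0n expn1 => /eqP.
by rewrite -[_ == _]/(p %| m)%N; apply/negP; rewrite -prime_coprime.
Qed.

(** Division by [d] costs a loss of precision [v] that depends on [d] only. *)
Lemma cong_cancel d : (0 < d)%N -> exists v, forall M x y,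
  cong (M + v) (d%:R * x) (d%:R * y) -> cong M x y.
Proof.
move=> d0; have [v [e vE]] := nat_dvd_pX d0; exists v => M x y /congP[z zE].
apply/congP; exists (e * z); apply: (mulIn d0); rewrite zE exprD vE.
by ring.
Qed.

End Congruences.
#[global] Hint Resolve congxx : core.

(** * Binomial coefficients and powers *)

Section BinomialPowers.
Variables (p : nat) (pr : prime p).
Local Notation Zp := (padicZ pr).
Implicit Types (x y z s t u : Zp) (n : nat).

Lemma prod_natB a n : \prod_(i < n) (a%:R - i%:R : Zp) = (a ^_ n)%:R.
Proof.
elim: n => [|n IH]; first by rewrite big_ord0.
rewrite big_ord_recr /= IH ffactnSr natrM.
have [na|an] := leqP n a; first by rewrite natrB.
by rewrite ffact_small // !mul0r.
Qed.

(** Choose [v] with [p ^ v] divisible by [n]![. Modulo]p ^ v[the product agrees with a falling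
    factorial of a natural number, which is divisible by]n[!] as well. *)
Lemma binomZpE s n : binomZp s n * n`!%:R = \prod_(i < n) (s - i%:R).
Proof.
suff ex : exists b, b * n`!%:R = \prod_(i < n) (s - i%:R) by exact: (xgetPex 0 ex).
have [v [e vE]] := nat_dvd_pX pr (fact_gt0 n).
have : cong v (\prod_(i < n) (s - i%:R)) (residue s v ^_ n)%:R.
  by rewrite -prod_natB; apply: cong_prod => i _; apply/congB/congxx/cong_residue.
case/congP => z ->; exists ('C(residue s v, n)%:R + e * z).
by rewrite -bin_ffact natrM vE; ring.
Qed.

Lemma binomZp_nat a n : binomZp (a%:R : Zp) n = 'C(a, n)%:R.
Proof.
apply: (mulIn (fact_gt0 n)).
by rewrite mulrC binomZpE prod_natB -bin_ffact natrM mulrC.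
Qed.

Lemma binomZp_cont n : exists v, forall M s t,
  cong (M + v) s t -> cong M (binomZp s n) (binomZp t n).
Proof.
have [v vP] := cong_cancel pr (fact_gt0 n); exists v => M s t st.
apply: vP; rewrite ![n`!%:R * _]mulrC !binomZpE.
by apply: cong_prod => i _; apply/congB/congxx.
Qed.

Lemma cong_mulX n u k b : (n <= k)%N -> cong 1 u 1 -> cong n (b * (u - 1) ^+ k) 0.
Proof.
move=> nk /congP[z ->]; apply: (congW nk); rewrite expr1 addrAC subrr add0r.
by rewrite exprMn mulrCA; apply: cong_pX.
Qed.

Lemma cong_series (f : nat -> Zp) M L : (M <= L)%N ->
  (forall k, (M <= k)%N -> cong M (f k) 0) -> cong M (series f L) (series f M).
Proof.
move=> ML fP; rewrite /series /= (big_cat_nat (leq0n M) ML) /=.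
rewrite -[X in cong _ _ X]addr0; apply: congD => //.
rewrite big_nat; apply: (big_ind (fun x => cong M x 0)) => // [x y x0 y0|k].
  by rewrite -[0]addr0; apply: congD.
by case/andP => /fP.
Qed.

(** Since [p] divides [u - 1], the terms of index at least [M] vanish modulo [p ^ M]. *)
Lemma powZp_truncate M s u : cong 1 u 1 ->
  cong M (powZp u s) (series (fun n => binomZp s n * (u - 1) ^+ n) M).
Proof.
move=> u1; set f := fun n => _.
have fP n k : (n <= k)%N -> cong n (f k) 0 by move=> nk; apply: cong_mulX.
have [|K KP] := @cauchy_cong _ pr (series f) _ M.
  move=> n; exists n => k nk; rewrite /series /= big_nat_recr //=.
  by rewrite -[X in cong _ _ X]addr0; apply/congD/fP.
apply: (@cong_trans _ _ _ _ (series f (maxn K M))).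
  by apply/cong_sym/KP; rewrite leq_maxl.
by apply: cong_series (fP M); rewrite leq_maxr.
Qed.

(** Modulo [p ^ M] the exponent can be replaced by a natural number, uniformly in [u]. The exponent
    laws and the continuity in [u] are then inherited from ordinary powers. *)
Lemma powZp_approx M s : exists V, forall a u,
  cong V s a%:R -> cong 1 u 1 -> cong M (powZp u s) (u ^+ a).
Proof.
have [v vP] := choice binomZp_cont.
exists (M + \max_(i < M) v i)%N => a u sa u1.
apply: cong_trans (powZp_truncate _ _ u1) _.
pose f n := 'C(a, n)%:R * (u - 1) ^+ n.
(* The finite binomial expansion is padded with zero terms so that it has at least [M] terms. *)
have uE : u ^+ a = series f (maxn M a.+1).
  rewrite -[u in LHS](subrK 1) exprD1n /series /=.
  rewrite (big_cat_nat (leq0n a.+1) (leq_maxr _ _)) /= big_mkord.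
  rewrite [X in _ = _ + X]big_nat [X in _ = _ + X]big1 ?addr0; last first.
    by move=> i /andP[ai _]; rewrite /f bin_small // mul0r.
  by apply: eq_bigr => i _; rewrite /f mulr_natl.
rewrite uE; apply: (@cong_trans _ _ _ _ (series f M)); last first.
  by apply: cong_sym; apply: cong_series; [exact: leq_maxl|move=> k Mk; apply: cong_mulX].
rewrite /series /= !big_mkord; apply: cong_sum => i _; apply: congM => //.
rewrite -binomZp_nat; apply: vP; apply: congW sa.
by rewrite leq_add2l; apply: (leq_bigmax i).
Qed.

Lemma powZpD u s t : cong 1 u 1 -> powZp u (s + t) = powZp u s * powZp u t.
Proof.
move=> u1; apply: cong_eq => M.
have [V1 V1P] := powZp_approx M s; have [V2 V2P] := powZp_approx M t.
have [V3 V3P] := powZp_approx M (s + t).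
pose V := maxn V1 (maxn V2 V3).
have sa : cong V s (residue s V)%:R by exact: cong_residue.
have tb : cong V t (residue t V)%:R by exact: cong_residue.
apply: (@cong_trans _ _ _ _ (u ^+ (residue s V + residue t V))).
  apply: V3P => //; apply: (@congW _ _ _ V); first by rewrite /V; lia.
  by rewrite natrD; apply: congD.
rewrite exprD; apply/cong_sym/congM; [apply: V1P|apply: V2P] => //.
  by apply: congW sa; rewrite /V; lia.
by apply: congW tb; rewrite /V; lia.
Qed.

Lemma powZp0 u : cong 1 u 1 -> powZp u 0 = 1.
Proof.
move=> u1; apply: cong_eq => M; have [V VP] := powZp_approx M 0.
exact: (VP 0%N).
Qed.

Lemma powZp_sum u (I : Type) (r : seq I) (P : pred I) (F : I -> Zp) : cong 1 u 1 ->
  powZp u (\sum_(i <- r | P i) F i) = \prod_(i <- r | P i) powZp u (F i).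
Proof.
move=> u1.
by apply: (big_morph (powZp u)); [move=> s t; exact: powZpD|exact: powZp0].
Qed.

Lemma powZp_cont n u u' s : cong 1 u 1 -> cong 1 u' 1 -> cong n u u' ->
  cong n (powZp u s) (powZp u' s).
Proof.
move=> u1 u1' e; have [V VP] := powZp_approx n s.
have sa : cong V s (residue s V)%:R by exact: cong_residue.
apply: cong_trans (VP _ _ sa u1) _; apply: cong_sym.
by apply: cong_trans (VP _ _ sa u1') _; apply/congX/cong_sym.
Qed.

End BinomialPowers.

(** * The Teichmuller character *)

Section Teichmuller.
Variables (p : nat) (pr : prime p).
Local Notation Zp := (padicZ pr).
Implicit Types (x y z w : Zp) (n : nat).

(* The numerals [2] and [4] in [qp] and [inW] are [2%:R] and [4%:R] in [nat]. *)
Lemma qpE : qp p = (if p == 2%N then 4%N else p). Proof. by []. Qed.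

Lemma inWE w : inW w = (if p == 2%N then w = 1 \/ w = -1 else w ^+ p.-1 = 1).
Proof. by []. Qed.

Lemma inW_unit w : inW w -> w \is a GRing.unit.
Proof.
rewrite !inWE; case: eqP => [_ [] ->|_ e]; rewrite ?unitrN ?unitr1 //.
by rewrite -(@unitrX_pos _ _ p.-1) ?e ?unitr1 // -subn1 subn_gt0 prime_gt1.
Qed.

Lemma qp_cong1 z : cong 1 (1 + (qp p)%:R * z) 1.
Proof.
rewrite -[X in cong _ _ X]addr0; apply: congD => //.
rewrite qpE; case: eqP => [p2|_]; last by have := @cong_pX _ pr 1 z; rewrite expr1.
have -> : 4%N = (p ^ 2)%N by rewrite p2.
by rewrite natrX; apply: (@congW _ _ 1 2) => //; apply: cong_pX.
Qed.

(** This makes [p ^ 2] a modulus for the local constancy of [omega] that serves all [p] alike. *)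
Lemma qp_dvd : exists e : Zp, p%:R ^+ 2 = (qp p)%:R * e.
Proof.
rewrite qpE; case: eqP => [p2|_]; last by exists p%:R; rewrite expr2.
by exists 1; rewrite mulr1 -natrX; congr _%:R; rewrite p2.
Qed.

Lemma odd_prime_pred : p <> 2%N -> odd p.-1 = false.
Proof.
by move=> p2; case: (even_prime pr) => // op; apply/negbTE; rewrite -oddS prednK ?prime_gt0.
Qed.

Lemma inWN w : inW w -> inW (- w).
Proof.
rewrite !inWE; case: eqP => [_ [] ->|p2 e]; [by right|by left; rewrite opprK|].
by rewrite exprNn e mulr1 -signr_odd odd_prime_pred.
Qed.

(** For [p = 2], 1 and -1 differ modulo 4. For odd [p], the quotient [v] of [w] by [w'] is a root of
    unity of order dividing [p - 1] and congruent to 1. If [v] were not 1, the sum of its powers of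
    exponent 0 to [p - 2] would be 0, but it is congruent to [p - 1]. *)
Lemma inW_uniq w w' y y' : inW w -> inW w' ->
  w * (1 + (qp p)%:R * y) = w' * (1 + (qp p)%:R * y') -> w = w'.
Proof.
move=> Ww Ww' e; have uw' := inW_unit Ww'.
have c1 : cong 1 w w'.
  apply: (@cong_trans _ _ _ _ (w * (1 + (qp p)%:R * y))).
    by rewrite -{1}[w]mulr1; apply/congM/cong_sym/qp_cong1.
  by rewrite e -{2}[w']mulr1; apply/congM/qp_cong1.
move: (Ww) (Ww') e; rewrite !inWE qpE; case: eqP => [p2|p2].
  have contra z : 1 = -1 + 4%:R * z -> False.
    have p4 : (p ^ 2 = 4)%N by rewrite p2.
    have -> : 4%:R * z = p%:R ^+ 2 * z by rewrite -natrX p4.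
    move=> /(fun H => iffRL (congP 2 1 (-1)) (ex_intro _ z H)).
    rewrite /cong resN -[1]/(1%:R) !res_nat.
    by rewrite p4.
  case=> -> [] -> // e; [case: (contra (- y - y'))|case: (contra (- y' - y))].
    have -> : -1 + 4%:R * (- y - y') = -1 * (1 + 4%:R * y') - 4%:R * y by ring.
    by rewrite -e; ring.
  have -> : -1 + 4%:R * (- y' - y) = -1 * (1 + 4%:R * y) - 4%:R * y' by ring.
  by rewrite e; ring.
move=> e e' _; pose v := w / w'.
have v1 : v ^+ p.-1 = 1 by rewrite exprMn exprVn e e' invr1 mulr1.
have cv : cong 1 v 1.
  by rewrite /v -(divrr uw'); apply: congM.
have := subrX1 v p.-1; rewrite v1 subrr => /esym/eqP; rewrite mulf_eq0.
case/orP => [|/eqP s0].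
  by rewrite subr_eq0 => /eqP vE; rewrite -(divrK uw' w) -/v vE mul1r.
have : cong 1 (\sum_(i < p.-1) v ^+ i) (\sum_(i < p.-1) 1).
  by apply: cong_sum => i _; rewrite -(expr1n _ i); apply: congX.
rewrite s0 sumr_const card_ord /cong -[0]/(0%:R) !res_nat expn1 mod0n.
move=> e0; exfalso; move: e0 (prime_gt1 pr) => {s0 v1 e e' uw' c1 cv}.
by case: p p2 => [|[|n]] // _; rewrite modn_small.
Qed.

Lemma omega_eq x w y : inW w -> x = w * (1 + (qp p)%:R * y) -> omega x = w.
Proof.
move=> Ww xE; rewrite /omega; case: xgetP => [_ -> [Ww' [y' yE]]|/(_ w)].
  by apply: (@inW_uniq _ _ y' y) => //; rewrite -yE.
by case; split => //; exists y.
Qed.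

(** For [p = 2] the sign is read off modulo 4. For odd [p], [w] is the limit of [x ^+ (p ^ n)],
    which is Cauchy by Euler's theorem. *)
Lemma teichmuller_ex x : x \is a GRing.unit ->
  exists w, inW w /\ exists y, x = w * (1 + (qp p)%:R * y).
Proof.
move=> ux; have nx := iffLR (unitZpP x) ux.
case: (p =P 2%N) => p2.
  have q4 : qp p = 4%N by rewrite qpE p2.
  have W1 : inW (1 : Zp) by rewrite inWE; case: eqP => // _; left.
  have p4 : (p ^ 2 = 4)%N by rewrite p2.
  have : cong 2 x 1 \/ cong 2 x (-1).
    have := nx; rewrite /cong -(res_le x (isT : 1 <= 2)%N) resN -[1]/(1%:R) -[0]/(0%:R).
    rewrite !res_nat; have := res_lt x 2; rewrite p4 expn1 {3 4}p2.
    by case: (residue x 2) => [|[|[|[|]]]] //=; auto.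
  case=> /congP[z ->]; rewrite -natrX p4 q4.
    by exists 1; split; [|exists z; rewrite mul1r].
  by exists (-1); split; [exact: inWN|exists (- z); ring].
have qE : qp p = p by rewrite qpE; case: eqP.
have E n := @euler_cong _ _ x n nx.
have tE n : totient (p ^ n.+1) = (p ^ n * p.-1)%N by rewrite totient_pfactor // mulnC.
have pS : (p.-1.+1 = p)%N by rewrite prednK ?prime_gt0.
have [|w wP] := @cong_complete _ pr (fun n => x ^+ (p ^ n)).
  move=> n; apply: (@congW _ _ n n.+1) => //.
  have -> : (p ^ n.+1 = p ^ n + totient (p ^ n.+1))%N.
    by rewrite tE -mulnS pS expnSr.
  by rewrite exprD -[X in cong _ _ X]mulr1; apply: congM.
have w1 : w ^+ p.-1 = 1.
  apply: cong_eq => n; apply: (@cong_trans _ _ _ _ (x ^+ (p ^ n * p.-1))).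
    by rewrite exprM; apply/congX/cong_sym.
  by rewrite -tE; apply: (@congW _ _ n n.+1).
have uw : w \is a GRing.unit.
  by apply: inW_unit; rewrite inWE; case: eqP.
have /congP[z zE] : cong 1 x w.
  apply: cong_trans (wP 1%N); rewrite expn1 -[X in _ ^+ X]pS exprS.
  rewrite -[X in cong _ X _]mulr1.
  apply: congM => //; apply: cong_sym; have := E 1%N.
  by rewrite (tE 0%N) expn0 mul1n.
exists w; split; first by rewrite inWE; case: eqP.
exists (z / w); rewrite qE.
by rewrite mulrDr mulr1 mulrCA [w * _]mulrC divrK // zE expr1.
Qed.

Lemma omegaP x : x \is a GRing.unit ->
  inW (omega x) /\ exists y, x = omega x * (1 + (qp p)%:R * y).
Proof.
by move=> /teichmuller_ex[w [Ww [y xE]]]; rewrite (omega_eq Ww xE); split=> //; exists y.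
Qed.

Lemma omega_unit x : x \is a GRing.unit -> omega x \is a GRing.unit.
Proof. by case/omegaP => /inW_unit. Qed.

Lemma omegaN x : x \is a GRing.unit -> omega (- x) = - omega x.
Proof.
case/omegaP => Ww [y xE]; apply: (@omega_eq _ _ y); first exact: inWN.
by rewrite {1}xE mulNr.
Qed.

Lemma omega_cont x y : x \is a GRing.unit -> cong 2 x y -> omega x = omega y.
Proof.
move=> ux /cong_sym/congP[z yE]; have [Ww [t xE]] := omegaP ux.
have [e eE] := qp_dvd; have uw := omega_unit ux.
apply/esym/(@omega_eq _ _ (t + e * z / omega x)) => //.
rewrite yE {1}xE eE; set w := omega x in uw *; set d := e * z / w.
have -> : w * (1 + (qp p)%:R * (t + d)) = w * (1 + (qp p)%:R * t) + (qp p)%:R * (d * w).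
  by ring.
by rewrite divrK // mulrA.
Qed.

Lemma angle_cong1 x : x \is a GRing.unit -> cong 1 (angle x) 1.
Proof.
move=> ux; have [_ [y xE]] := omegaP ux.
by rewrite /angle {1}xE mulrC mulKr ?omega_unit //; apply: qp_cong1.
Qed.

Lemma angleN x : x \is a GRing.unit -> angle (- x) = angle x.
Proof. by move=> ux; rewrite /angle omegaN // invrN mulrNN. Qed.

Lemma angle_cont n x y : x \is a GRing.unit -> (1 < n)%N -> cong n x y ->
  cong n (angle x) (angle y).
Proof.
move=> ux n2 e; rewrite /angle (omega_cont ux (congW n2 e)).
exact: congM.
Qed.

End Teichmuller.

(** * Measures *)

Section Measures.
Variables (p : nat) (pr : prime p).
Local Notation Zp := (padicZ pr).
Implicit Types (x y z c : Zp) (n N M K : nat) (m : measureZp pr) (phi : Zp -> Zp).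

Definition periodic N phi := forall x y, cong N x y -> phi x = phi y.

Lemma periodicW N K phi : (N <= K)%N -> periodic N phi -> periodic K phi.
Proof. by move=> NK per x y e; apply/per/(congW NK). Qed.

Definition ucont (r : nat) (f : ('I_r -> Zp) -> Zp) := forall M, exists N,
  forall x y : 'I_r -> Zp, (forall j, cong N (x j) (y j)) -> cong M (f x) (f y).

Definition riemann (r : nat) m (f : ('I_r -> Zp) -> Zp) N : Zp :=
  \sum_(a : {ffun 'I_r -> 'I_(p ^ N)})
    f (fun j => (a j : nat)%:R) * \prod_j mass m (a j).

Definition redp N (b : 'I_(p ^ N.+1)) : 'I_(p ^ N) :=
  Ordinal (ltn_pmod b (expp_gt0 pr N)).

Lemma mass_redp m N (a : 'I_(p ^ N)) : mass m a = \sum_(b | redp b == a) mass m b.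
Proof. by rewrite mass_additive; apply: eq_bigl => b; rewrite -val_eqE. Qed.

Lemma cong_redp N (b : 'I_(p ^ N.+1)) : cong N (b%:R : Zp) (redp b)%:R.
Proof. exact: cong_mod. Qed.

(** Additivity refines the sum to level [N.+1] while keeping the sample points of level [N], so that
    consecutive Riemann sums can be compared term by term. *)
Lemma riemann_redp (r : nat) m (f : ('I_r -> Zp) -> Zp) N :
  riemann m f N = \sum_(b : {ffun 'I_r -> 'I_(p ^ N.+1)})
    f (fun j => (redp (b j) : nat)%:R) * \prod_j mass m (b j).
Proof.
pose red (b : {ffun 'I_r -> 'I_(p ^ N.+1)}) := [ffun j => redp (b j)].
rewrite (partition_big red xpredT) //=; apply: eq_bigr => a _.
rewrite (eq_bigr (fun j => \sum_(b | redp b == a j) mass m b)); last first.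
  by move=> j _; apply: mass_redp.
rewrite (bigA_distr_big_dep (fun j b => redp b == a j) (fun j b => mass m b)).
rewrite mulr_sumr; apply: eq_big => [b|b /familyP ba].
  apply/familyP/eqP => [ba|ba j]; last by rewrite unfold_in -ba ffunE.
  by apply/ffunP => j; rewrite ffunE; apply/eqP/ba.
by congr (f _ * _); apply/funext => j; rewrite -(eqP (ba j : redp (b j) == a j)).
Qed.

Lemma riemann_cvg (r : nat) m (f : ('I_r -> Zp) -> Zp) : ucont f ->
  forall M, exists N, forall K, (N <= K)%N ->
    cong M (riemann m f K) (integralZp m f).
Proof.
move=> fc; apply: cauchy_cong => M; have [N NP] := fc M; exists N => K NK.
rewrite [X in cong _ _ X]riemann_redp; apply: cong_sum => b _.
by apply: congM => //; apply: NP => j; apply: congW NK _; apply: cong_redp.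
Qed.

Lemma integralZp0 (r : nat) m (f : ('I_r -> Zp) -> Zp) :
  (forall N, riemann m f N = 0) -> integralZp m f = 0.
Proof.
move=> f0; apply: lim_cong => n; exists 0%N => k _.
by rewrite /cong -/(riemann _ _ _) f0.
Qed.

(** For [phi] of period [p ^ N] this is the exact integral: by [rsum_le] a higher level gives the
    same value. *)
Definition rsum m N phi : Zp := \sum_(a < p ^ N) mass m a * phi a%:R.

Lemma rsum_redp m N phi :
  rsum m N phi = \sum_(b < p ^ N.+1) mass m b * phi (redp b)%:R.
Proof.
rewrite (partition_big (@redp N) xpredT) //=; apply: eq_bigr => a _.
by rewrite mass_redp mulr_suml; apply: eq_bigr => b /eqP <-.
Qed.

Lemma rsumS m N phi : periodic N phi -> rsum m N.+1 phi = rsum m N phi.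
Proof.
move=> per; rewrite [RHS]rsum_redp; apply: eq_bigr => b _.
by rewrite (per _ _ (cong_redp b)).
Qed.

Lemma rsum_le m N K phi : (N <= K)%N -> periodic N phi -> rsum m K phi = rsum m N phi.
Proof.
move=> NK per; rewrite -(subnKC NK); elim: (K - N)%N => [|d IH]; first by rewrite addn0.
by rewrite addnS rsumS //; apply: periodicW per; apply: leq_addr.
Qed.

Lemma riemann1 m N phi : riemann m (fun x : 'I_1 -> Zp => phi (x ord0)) N = rsum m N phi.
Proof.
rewrite /riemann /rsum.
rewrite (reindex (fun a : 'I_(p ^ N) => [ffun _ : 'I_1 => a])) /=.
  by apply: eq_bigr => a _; rewrite big_ord1 !ffunE mulrC.
exists (fun b => b ord0) => [a _|b _]; first by rewrite ffunE.
by apply/ffunP => j; rewrite ffunE [j]ord1.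
Qed.

Lemma rsum_lin m N n (k : 'I_n -> Zp) (F : 'I_n -> Zp -> Zp) :
  rsum m N (fun x => \sum_b k b * F b x) = \sum_b k b * rsum m N (F b).
Proof.
rewrite /rsum; under eq_bigr do rewrite mulr_sumr.
rewrite exchange_big /=; apply: eq_bigr => b _.
by rewrite mulr_sumr; apply: eq_bigr => a _; rewrite mulrCA.
Qed.

Lemma corresponds_cong m g n M : corresponds m g -> exists N, forall K, (N <= K)%N ->
  cong M (\sum_(a < p ^ K) mass m a * 'C(a, n)%:R) (g n).
Proof.
move=> /(_ n) <-; have fc : ucont (fun x : 'I_1 -> Zp => binomZp (x ord0) n).
  have [v vP] := binomZp_cont pr n => M'; exists (M' + v)%N => x y e.
  exact: vP.
have [N NP] := riemann_cvg m fc M; exists N => K /NP.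
rewrite (riemann1 m K (fun x => binomZp x n)) => /(cong_trans _); apply.
by apply: cong_sum => a _; rewrite binomZp_nat.
Qed.

Definition ballind N (b : nat) : Zp -> Zp := fun x => (residue x N == b %% p ^ N)%N%:R.

Lemma ballind_periodic N b : periodic N (ballind N b).
Proof. by move=> x y e; rewrite /ballind e. Qed.

Lemma periodic_sum N phi : periodic N phi ->
  phi = fun x => \sum_(b < p ^ N) phi b%:R * ballind N b x.
Proof.
move=> per; apply/funext => x; rewrite (bigD1 (Ordinal (res_lt x N))) //=.
rewrite /ballind res_mod eqxx mulr1 (per _ _ (cong_residue N x)) big1 ?addr0 //.
move=> b bx; rewrite modn_small // (_ : (_ == _) = false) ?mulr0 //.
by apply: contraNF bx => /eqP e; apply/eqP/val_inj; rewrite /= e.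
Qed.

(* A translation-invariant [Lam] gives every ball of radius [p ^- N] the same mass
   [v], and the total mass [p ^ N * v] is then divisible by all powers of [p]. *)
Lemma no_haar (u : Zp) (Lam : nat -> (Zp -> Zp) -> Zp) : u \is a GRing.unit ->
  (forall N n (k : 'I_n -> Zp) (F : 'I_n -> Zp -> Zp),
     Lam N (fun x => \sum_b k b * F b x) = \sum_b k b * Lam N (F b)) ->
  (forall N phi, periodic N phi -> Lam N.+1 phi = Lam N phi) ->
  (forall N phi, periodic N phi -> Lam N (fun x => phi (x + u)) = Lam N phi) ->
  forall N phi, periodic N phi -> Lam N phi = 0.
Proof.
move=> uu lin level inv.
have invn N phi k : periodic N phi -> Lam N (fun x => phi (x + k%:R * u)) = Lam N phi.
  elim: k => [|k IH] per.
    by congr (Lam N _); apply/funext => x; rewrite mul0r addr0.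
  rewrite -(IH per) -[RHS]inv.
    by congr (Lam N _); apply/funext => x; rewrite -natr1; congr phi; ring.
  by move=> x y e; apply/per/congD.
(* On functions of period [p ^ N], translating by 1 amounts to translating [residue u^-1 N] times by
   [u]. *)
have inv1 N phi : periodic N phi -> Lam N (fun x => phi (x + 1)) = Lam N phi.
  move=> per; rewrite -(invn _ _ (residue u^-1 N) per).
  congr (Lam N _); apply/funext => x; apply/per/congD => //.
  rewrite -[X in cong _ X _](mulVr uu); apply: congM => //.
  exact: cong_residue.
have indS N b : Lam N (ballind N b.+1) = Lam N (ballind N b).
  rewrite -inv1; last exact: ballind_periodic.
  congr (Lam N _); apply/funext => x; rewrite /ballind resD.
  rewrite -[1]/(1%:R) res_nat modnDmr -[b.+1]addn1 eqn_modDr.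
  by rewrite res_mod.
have ind0 N b : Lam N (ballind N b) = Lam N (ballind N 0).
  by elim: b => // b IH; rewrite indS.
have decomp N phi : periodic N phi ->
    Lam N phi = (\sum_(b < p ^ N) phi b%:R) * Lam N (ballind N 0).
  move=> per; rewrite {1}(periodic_sum per) lin mulr_suml.
  by apply: eq_bigr => b _; rewrite ind0.
have one N : Lam 0%N (fun=> 1) = p%:R ^+ N * Lam N (ballind N 0).
  transitivity (Lam N (fun=> 1)).
    by elim: N => // N ->; rewrite level.
  by rewrite decomp // sumr_const card_ord -natrX.
have one0 : Lam 0%N (fun=> 1) = 0.
  by apply: cong_eq => N; rewrite (one N); apply: cong_pX.
move=> N phi per; rewrite decomp //; suff -> : Lam N (ballind N 0) = 0 by rewrite mulr0.
apply: (@mulIn _ pr (p ^ N)); first exact: expp_gt0.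
by rewrite natrX -one mulr0.
Qed.

End Measures.

(** * Power series and locally constant functions *)

Section Pairing.
Variables (p : nat) (pr : prime p).
Local Notation Zp := (padicZ pr).
Implicit Types (x y z : Zp) (n N M : nat) (phi : Zp -> Zp) (Q R : {poly Zp}).

Definition fdiff phi : Zp -> Zp := fun x => phi (x + 1) - phi x.

(* The indeterminate acts on functions as the difference operator, so that [1 + 'X]
   acts as the translation by 1. *)
Definition pair phi Q : Zp := \sum_(i < size Q) Q`_i * iter i fdiff phi 0.

Lemma pair_wide n phi Q : (size Q <= n)%N ->
  pair phi Q = \sum_(i < n) Q`_i * iter i fdiff phi 0.
Proof.
move=> Qn; rewrite /pair (big_ord_widen n (fun i => Q`_i * iter i fdiff phi 0) Qn).
rewrite big_mkcond; apply: eq_bigr => i _; case: ltnP => // Qi.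
by rewrite nth_default // mul0r.
Qed.

Lemma pairB phi Q R : pair phi (Q - R) = pair phi Q - pair phi R.
Proof.
pose n := maxn (size Q) (size R).
have QRn : (size (Q - R)%R <= n)%N.
  by apply: leq_trans (size_polyD _ _) _; rewrite size_polyN.
rewrite (pair_wide _ QRn) (@pair_wide n _ Q) ?leq_maxl // (@pair_wide n _ R) ?leq_maxr //.
by rewrite -sumrB; apply: eq_bigr => i _; rewrite coefB mulrBl.
Qed.

HB.instance Definition _ phi :=
  GRing.isZmodMorphism.Build {poly Zp} Zp (pair phi) (pairB phi).

Lemma pairZ phi a Q : pair phi (a *: Q) = a * pair phi Q.
Proof.
rewrite (@pair_wide (size Q)) ?size_scale_leq // /pair mulr_sumr.
by apply: eq_bigr => i _; rewrite coefZ mulrA.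
Qed.

Lemma pair1 phi : pair phi 1 = phi 0.
Proof. by rewrite /pair size_poly1 big_ord1 coef1 mul1r. Qed.

Lemma pairMX phi Q : pair phi (Q * 'X) = pair (fdiff phi) Q.
Proof.
rewrite (@pair_wide (size Q).+1); last first.
  by have [->|Q0] := eqVneq Q 0; rewrite ?mul0r ?size_poly0 // size_mulX.
rewrite big_ord_recl coefMX mul0r add0r; apply: eq_bigr => i _.
by rewrite coefMX -iterSr.
Qed.

Lemma iter_fdiff_shift i phi x :
  iter i fdiff (fun y => phi (y + 1)) x = iter i fdiff phi (x + 1).
Proof. by elim: i x => //= i IH x; rewrite /fdiff !IH. Qed.

Lemma pairM1X phi Q : pair phi (Q * (1 + 'X)) = pair (fun x => phi (x + 1)) Q.
Proof.
rewrite mulrDr mulr1 raddfD /= pairMX /pair -big_split /=; apply: eq_bigr => i _.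
by rewrite -mulrDr -iterSr iterS iter_fdiff_shift /fdiff addrCA subrr addr0.
Qed.

Lemma pairM1Xn phi Q n :
  pair phi (Q * (1 + 'X) ^+ n) = pair (fun x => phi (x + n%:R)) Q.
Proof.
elim: n phi => [|n IH] phi.
  by rewrite mulr1; congr pair; apply/funext => x; rewrite addr0.
rewrite exprSr mulrA pairM1X IH; congr pair; apply/funext => x.
by rewrite -addrA natr1.
Qed.

Lemma pair1Xn phi n : pair phi ((1 + 'X) ^+ n) = phi n%:R.
Proof. by rewrite -[X in pair _ X]mul1r pairM1Xn pair1 add0r. Qed.

(** The middle binomial coefficients of a [p]-th power are divisible by [p]; this is iterated [N]
    times. *)
Lemma exprD_expp (A : comNzRingType) (x y : A) N :
  exists h, (x + y) ^+ (p ^ N) = x ^+ (p ^ N) + y ^+ (p ^ N) + p%:R * h.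
Proof.
have one (a b : A) : exists h, (a + b) ^+ p = a ^+ p + b ^+ p + p%:R * h.
  have p0 := prime_gt0 pr; pose F i := a ^+ (p - i) * b ^+ i *+ 'C(p, i).
  rewrite exprDn -(big_mkord xpredT F) big_nat_recr //= big_ltn // /F subn0 subnn.
  rewrite bin0 binn !mulr1n !expr0 mulr1 mul1r.
  exists (\sum_(1 <= i < p) (a ^+ (p - i) * b ^+ i) *+ ('C(p, i) %/ p)).
  rewrite mulr_sumr addrAC; congr (_ + _); apply: eq_big_nat => i /andP[i0 ip].
  by rewrite mulr_natl -mulrnA divnK // prime_dvd_bin // i0.
elim: N => [|N [h hE]]; first by exists 0; rewrite mulr0 addr0.
rewrite expnSr !exprM hE; have [h1 ->] := one (x ^+ (p ^ N) + y ^+ (p ^ N)) (p%:R * h).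
have [h2 ->] := one (x ^+ (p ^ N)) (y ^+ (p ^ N)).
have -> : (p%:R * h) ^+ p = p%:R * (p%:R ^+ p.-1 * h ^+ p).
  by rewrite exprMn mulrA -exprS prednK ?prime_gt0.
by exists (h2 + p%:R ^+ p.-1 * h ^+ p + h1); rewrite !mulrDr; ring.
Qed.

(* Modulo [p], ['X ^+ (p ^ N)] is [(1 + 'X) ^+ (p ^ N) - 1], which kills the functions
   of period [p ^ N]. *)
Lemma pair_XnM N phi M Q : periodic N phi -> cong M (pair phi (Q * 'X ^+ (M * p ^ N))) 0.
Proof.
move=> per; elim: M Q => [|M IH] Q; first exact: cong0.
have [h hE] := exprD_expp 1 ('X : {poly Zp}) N.
have XE : 'X^(p ^ N) = (1 + 'X) ^+ (p ^ N) - 1 - p%:R * h :> {poly Zp}.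
  by rewrite hE expr1n; ring.
set R := Q * 'X^(M * p ^ N).
have -> : Q * 'X^(M.+1 * p ^ N) =
    R * (1 + 'X) ^+ (p ^ N) - R - (p%:R : Zp) *: (h * Q * 'X^(M * p ^ N)).
  rewrite scaler_nat -mulr_natl mulSn exprD [Q * (_ * _)]mulrCA -/R XE.
  by rewrite -mulrA -/R; ring.
rewrite !raddfB /= pairM1Xn pairZ.
have -> : (fun x => phi (x + (p ^ N)%:R)) = phi.
  apply/funext => x; apply: per; rewrite natrX -[p%:R ^+ N]mulr1 -[X in cong _ _ X]addr0.
  exact/congD/cong_pX.
rewrite subrr sub0r -oppr0; apply: congN.
by have /cong0P[z ->] := IH (h * Q); rewrite mulrA -exprS; apply: cong_pX.
Qed.

(** The terms of degree at least [M * p ^ N] are negligible by [pair_XnM]. Hence finitely many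
    coefficient congruences control the integral of a locally constant function. *)
Lemma pair_cong N phi M Q : periodic N phi ->
  (forall n, (n < M * p ^ N)%N -> cong M Q`_n 0) -> cong M (pair phi Q) 0.
Proof.
move=> per Q0; pose L := (M * p ^ N)%N.
have QE : Q = take_poly L Q + drop_poly L Q * 'X^L by rewrite poly_take_drop.
rewrite QE raddfD /= -[0]addr0; apply: congD; last exact: pair_XnM.
rewrite (pair_wide _ (size_take_poly _ _)).
apply: (big_ind (fun x => cong M x 0)) => // [x y x0 y0|i _].
  by rewrite -[0]addr0; apply: congD.
rewrite coef_take_poly ltn_ord -[X in cong _ _ X](mul0r (iter i fdiff phi 0)).
by apply: congM => //; apply: Q0.
Qed.

End Pairing.

(** * The reflection formula for [mtilde c] *)

Section Reflection.
Variables (p : nat) (pr : prime p).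
Local Notation Zp := (padicZ pr).
Implicit Types (x y z c : Zp) (n N M K L : nat) (m : measureZp pr) (phi : Zp -> Zp).
Implicit Types (Q R : {poly Zp}).

(** A polynomial approximation of the power series of [m]: the level [K] element of the group ring,
    with the class of [a] lifted to [(1 + 'X) ^+ a]. *)
Definition measure_poly m K : {poly Zp} := \sum_(a < p ^ K) mass m a *: (1 + 'X) ^+ a.

Lemma coef_1Xn a n : (((1 + 'X) ^+ a : {poly Zp}))`_n = 'C(a, n)%:R.
Proof.
rewrite [1 + _]addrC exprD1n.
have -> : \sum_(i < a.+1) 'X^i *+ 'C(a, i) = \poly_(i < a.+1) ('C(a, i)%:R : Zp).
  by rewrite poly_def; apply: eq_bigr => i _; rewrite scaler_nat.
by rewrite coef_poly ltnS; case: leqP => // an; rewrite bin_small.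
Qed.

Lemma coef_measure_poly m K n :
  (measure_poly m K)`_n = \sum_(a < p ^ K) mass m a * 'C(a, n)%:R.
Proof. by rewrite coef_sum; apply: eq_bigr => a _; rewrite coefZ coef_1Xn. Qed.

Lemma pair_measure_poly phi m K b :
  pair phi (measure_poly m K * (1 + 'X) ^+ b) = rsum m K (fun x => phi (x + b%:R)).
Proof.
rewrite mulr_suml raddf_sum; apply: eq_bigr => a _ /=.
by rewrite -scalerAl pairZ pairM1Xn pair1Xn.
Qed.

Lemma coefM_cong L M Q R (f g : pseries pr) :
  (forall n, (n < L)%N -> cong M Q`_n (f n)) ->
  (forall n, (n < L)%N -> cong M R`_n (g n)) ->
  forall n, (n < L)%N -> cong M (Q * R)`_n (mulps f g n).
Proof.
move=> Qf Rg n nL; rewrite coefM; apply: cong_sum => i _; apply: congM.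
  by apply: Qf; apply: leq_ltn_trans nL; rewrite -ltnS.
by apply: Rg; apply: leq_ltn_trans nL; apply: leq_subr.
Qed.

Lemma bounded_choice L (P : nat -> nat -> Prop) :
  (forall n, exists N, forall K, (N <= K)%N -> P n K) ->
  exists N, forall K, (N <= K)%N -> forall n, (n < L)%N -> P n K.
Proof.
move=> /choice[N NP]; exists (\max_(i < L) N i)%N => K NK n nL; apply: NP.
exact: leq_trans (leq_bigmax (Ordinal nL)) NK.
Qed.

Lemma corresponds_coef m (g : pseries pr) L M : corresponds m g ->
  exists N, forall K, (N <= K)%N -> forall n, (n < L)%N ->
    cong M (measure_poly m K)`_n (g n).
Proof.
move=> mg; apply: bounded_choice => n; have [N NP] := corresponds_cong n M mg.
by exists N => K /NP; rewrite coef_measure_poly.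
Qed.

Lemma powps1_coef c L M : exists N, forall K, (N <= K)%N -> forall n, (n < L)%N ->
  cong M ((1 + 'X) ^+ residue c K - 1 : {poly Zp})`_n (powps1 c n).
Proof.
apply: bounded_choice => n; have [v vP] := binomZp_cont pr n.
exists (M + v)%N => K MK; rewrite coefB coef_1Xn coef1 /powps1.
case: eqP => [->|_]; first by rewrite bin0 subrr.
rewrite subr0 -binomZp_nat; apply/cong_sym/vP.
exact/(congW MK)/cong_residue.
Qed.

(** The low coefficients of [measure_poly m K] tend to 0, and pairing this polynomial with [phi]
    gives [rsum m K phi]. *)
Lemma rsum0 m : corresponds m (fun=> 0) ->
  forall N phi, periodic N phi -> rsum m N phi = 0.
Proof.
move=> m0 N phi per; apply: cong_eq => M.
have [K0 K0P] := corresponds_coef (M * p ^ N) M m0.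
pose K := maxn K0 N; rewrite -(@rsum_le _ _ _ _ K _ _ per) ?leq_maxr //.
have := pair_measure_poly phi m K 0; rewrite mulr1 => e.
have <- : rsum m K (fun x => phi (x + 0%:R)) = rsum m K phi.
  by congr (rsum _ _ _); apply/funext => x; rewrite addr0.
by rewrite -e; apply: (pair_cong per); apply: K0P; apply: leq_maxl.
Qed.

(** The cleared equation for [g] is paired with [phi]. Multiplication by ['X] and by the series
    [powps1 c] turns into taking differences with steps 1 and [c]. *)
Lemma measure_convolution c m (g : pseries pr) :
  mulps g (mulps (Tps pr) (powps1 c)) = (fun n => powps1 c n - c * Tps pr n) ->
  corresponds m g -> forall N phi, periodic N phi ->
  rsum m N (fun x => phi (x + 1 + c) - phi (x + 1) - phi (x + c) + phi x) =
  phi c - phi 0 - c * (phi 1 - phi 0).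
Proof.
move=> gE mg N phi per; apply: cong_eq => M; pose L := (M * p ^ N)%N.
have [K0 K0P] := corresponds_coef L M mg.
have [K1 K1P] := powps1_coef c L M.
(* The natural number [b] stands in for [c], so that the power series of exponent [c] becomes a
   polynomial. *)
pose K := maxn N (maxn K0 K1); pose b := residue c K.
have NK : (N <= K)%N by apply: leq_maxl.
have cb x : phi (x + b%:R) = phi (x + c).
  by apply: per; apply: congD => //; apply/(congW NK)/cong_sym/cong_residue.
pose A := measure_poly m K; pose q := (1 + 'X) ^+ b - 1 : {poly Zp}.
have XT n : ('X : {poly Zp})`_n = Tps pr n by rewrite coefX.
have qP n : (n < L)%N -> cong M q`_n (powps1 c n).
  by apply: K1P; rewrite /K !leq_max leqnn !orbT.
have lhs n : (n < L)%N -> cong M (A * ('X * q))`_n (powps1 c n - c * Tps pr n).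
  have -> : powps1 c n - c * Tps pr n = mulps g (mulps (Tps pr) (powps1 c)) n.
    by rewrite gE.
  apply: (@coefM_cong L) => [k kL|].
    by apply: K0P => //; rewrite /K !leq_max leqnn !orbT.
  by apply: coefM_cong => // k _; rewrite XT.
have : cong M (pair phi (A * ('X * q) - (q - c *: 'X))) 0.
  apply: (pair_cong per) => n nL; rewrite coefB.
  rewrite -[X in cong _ _ X](subrr (powps1 c n - c * Tps pr n)).
  apply: congB; first exact: lhs.
  by rewrite coefB coefZ XT; apply: congB => //; apply: qP.
have per' : periodic N (fun x => phi (x + 1 + c) - phi (x + 1) - phi (x + c) + phi x).
  move=> x y e; rewrite (per x y e); congr (_ - _ - _ + _); apply: per;
    by do ?apply: congD.
rewrite -(rsum_le m NK per').
have pX : pair phi 'X = phi 1 - phi 0.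
  by rewrite -['X]mul1r pairMX pair1 /fdiff add0r.
have -> : A * ('X * q) = A * (1 + 'X) ^+ (b.+1) - A * (1 + 'X) ^+ 1 -
    A * (1 + 'X) ^+ b + A * (1 + 'X) ^+ 0.
  by rewrite exprS expr1 expr0 /q; ring.
rewrite !(raddfB, raddfD) /= !pair_measure_poly pairZ pX pair1Xn pair1.
have -> : phi b%:R = phi c by rewrite -[b%:R]add0r cb add0r.
move=> /congD/(_ (congxx M (phi c - phi 0 - c * (phi 1 - phi 0)))).
rewrite add0r; apply: cong_trans; rewrite /cong; congr (residue _ _).
set e := phi c - phi 0 - _; set d := (X in _ = _ + X + _).
have -> : d = - e by rewrite /d /e; ring.
rewrite addrNK /rsum -!sumrB -big_split /=; apply: eq_bigr => a _.
have -> : phi (a%:R + b.+1%:R) = phi (a%:R + 1 + c) by rewrite -natr1 addrA addrAC cb.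
by rewrite addr0 cb -!mulrBr -mulrDr.
Qed.

(** The functional [Lam] is the defect of the formula. It kills double differences with steps 1 and
    [c], and [no_haar] removes the two differences one at a time. *)
Lemma rsum_reflect c m (g : pseries pr) : c \is a GRing.unit ->
  mulps g (mulps (Tps pr) (powps1 c)) = (fun n => powps1 c n - c * Tps pr n) ->
  corresponds m g -> forall N phi, periodic N phi ->
  rsum m N (fun x => phi x + phi (- x)) = (c - 1) * phi 0.
Proof.
move=> uc gE mg; have conv := measure_convolution gE mg.
pose Lam N phi := rsum m N (fun x => phi x + phi (- x)) - (c - 1) * phi 0.
have lin N n (k : 'I_n -> Zp) (F : 'I_n -> Zp -> Zp) :
    Lam N (fun x => \sum_b k b * F b x) = \sum_b k b * Lam N (F b).
  rewrite /Lam; have -> : (fun x => \sum_b k b * F b x + \sum_b k b * F b (- x)) =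
      (fun x => \sum_b k b * (F b x + F b (- x))).
    by apply/funext => x; rewrite -big_split; apply: eq_bigr => b _; rewrite mulrDr.
  rewrite (rsum_lin _ _ _ (fun b x => F b x + F b (- x))) mulr_sumr -sumrB.
  by apply: eq_bigr => b _; ring.
have perN N phi : periodic N phi -> periodic N (fun x => phi (- x)).
  by move=> per x y e; apply/per/congN.
have level N phi : periodic N phi -> Lam N.+1 phi = Lam N phi.
  move=> per; rewrite /Lam rsumS // => x y e.
  by rewrite (per _ _ e) (perN _ _ per _ _ e).
have LamB N phi psi : Lam N (fun x => phi x - psi x) = Lam N phi - Lam N psi.
  have := lin N 2 (fun i => if i == ord0 then 1 else - 1)
                  (fun i => if i == ord0 then phi else psi).
  rewrite !big_ord_recl !big_ord0 /= mul1r mulN1r addr0 => <-.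
  congr (Lam N _); apply/funext => x.
  by rewrite !big_ord_recl !big_ord0 /= mul1r mulN1r addr0.
have per1 N u phi : periodic N phi -> periodic N (fun x => phi (x + u)).
  by move=> per x y e; apply/per/congD.
have inv N phi : periodic N phi ->
    Lam N (fun x => phi (x + c + 1) - phi (x + c)) = Lam N (fun x => phi (x + 1) - phi x).
  move=> per; apply/eqP; rewrite -subr_eq0 -LamB; apply/eqP.
  have c1 := conv N phi per.
  (* This function is chosen so that its double difference at [x] is the double difference of [phi]
     at [- x]. *)
  have c2 := conv N (fun x => phi (- x + 1 + c)) (perN _ _ (per1 _ 1 _ (per1 _ c _ per))).
  rewrite /Lam; set S := rsum _ _ _.
  have -> : S = rsum m N (fun x => phi (x + 1 + c) - phi (x + 1) - phi (x + c) + phi x) +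
     rsum m N (fun x => (fun x => phi (- x + 1 + c)) (x + 1 + c) -
       (fun x => phi (- x + 1 + c)) (x + 1) - (fun x => phi (- x + 1 + c)) (x + c) +
       (fun x => phi (- x + 1 + c)) x).
    rewrite /S /rsum -big_split; apply: eq_bigr => a _ /=; rewrite -mulrDr.
    set x := a%:R.
    have -> : - (x + 1 + c) + 1 + c = - x by ring.
    have -> : - (x + 1) + 1 + c = - x + c by ring.
    have -> : - (x + c) + 1 + c = - x + 1 by ring.
    by rewrite [x + c + 1]addrAC [- x + c + 1]addrAC; ring.
  rewrite c1 c2.
  have -> : - c + 1 + c = 1 by ring.
  have -> : - 1 + 1 + c = c by ring.
  by rewrite !oppr0 !add0r [c + 1]addrC; ring.
(* By [inv] the composite of [Lam] with the difference of step 1 is invariant under translation by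
   the unit [c]. *)
have Lam1 N phi : periodic N phi -> Lam N (fun x => phi (x + 1) - phi x) = 0.
  move: N phi.
  apply: (no_haar uc (Lam := fun N phi => Lam N (fun x => phi (x + 1) - phi x))).
  - move=> N n k F; rewrite -lin; congr (Lam N _); apply/funext => x.
    by rewrite -sumrB; apply: eq_bigr => b _; rewrite mulrBr.
  - by move=> N phi per; rewrite level // => x y e;
    rewrite (per _ _ e) (per1 _ 1 _ per _ _ e).
  - move=> N phi per; rewrite -inv //; congr (Lam N _); apply/funext => x.
    by rewrite addrAC.
(* Now [Lam] itself is invariant under translation by 1. *)
move=> N phi per; apply/eqP; rewrite -subr_eq0; apply/eqP; move: N phi per.
apply: (no_haar (unitr1 _) (Lam := Lam)) => // N phi per.
by apply/eqP; rewrite -subr_eq0 -LamB Lam1.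
Qed.

(* The first case covers the default values of [mtilde] and [gc], so that neither has to
   be shown to exist. *)
Lemma mtilde_dichotomy c : c \is a GRing.unit ->
  (forall N phi, periodic N phi -> rsum (mtilde c) N phi = 0) \/
  (forall N phi, periodic N phi ->
     rsum (mtilde c) N (fun x => phi x + phi (- x)) = (c - 1) * phi 0).
Proof.
move=> uc; rewrite /mtilde; case: xgetP => [m _ mg|_]; last first.
  by left=> N phi _; rewrite /rsum big1 // => a _; rewrite mul0r.
move: mg; rewrite /gc; case: xgetP => [g _ gE|_] mg; last by left; apply: rsum0.
by right; apply: rsum_reflect gE mg.
Qed.

Lemma rsumD m N phi psi :
  rsum m N (fun x => phi x + psi x) = rsum m N phi + rsum m N psi.
Proof. by rewrite /rsum -big_split; apply: eq_bigr => a _; rewrite mulrDr. Qed.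

Lemma rsum_ballind m N (a : 'I_(p ^ N)) : rsum m N (ballind N a) = mass m a.
Proof.
rewrite /rsum (bigD1 a) //= /ballind res_nat !modn_small // eqxx mulr1 big1 ?addr0 //.
move=> b ba; rewrite res_nat modn_small // (_ : (_ == _) = false) ?mulr0 //.
exact/negbTE.
Qed.

Definition oppp N (a : 'I_(p ^ N)) : 'I_(p ^ N) := Ordinal (res_lt (- a%:R : Zp) N).

Lemma cong_oppp N (a : 'I_(p ^ N)) : cong N (oppp a)%:R (- a%:R : Zp).
Proof. exact/cong_sym/cong_residue. Qed.

Lemma opppK N : involutive (@oppp N).
Proof.
move=> a; apply/val_inj; transitivity (residue (- - (a%:R : Zp)) N).
  exact: (congN (cong_oppp a)).
by rewrite opprK res_nat modn_small.
Qed.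

Lemma oppp_eq0 N (a : 'I_(p ^ N)) : (oppp a == 0%N :> nat) = (a == 0%N :> nat).
Proof.
have z (b : 'I_(p ^ N)) : b = 0%N :> nat -> oppp b = 0%N :> nat.
  move=> b0; rewrite -[LHS]/(residue (- (b : nat)%:R : Zp) N) b0 oppr0.
  by rewrite -(mulr0n (1 : Zp)) res_nat mod0n.
by apply/eqP/eqP => /z; rewrite ?opppK.
Qed.

(** The mass of twice [mtilde c] plus [1 - c] times the Dirac measure at 0. Doubling avoids the
    division by 2, which is impossible in [Zp] when [p = 2]. *)
Definition oddmass c N (a : 'I_(p ^ N)) : Zp :=
  2%:R * mass (mtilde c) a + (if a == 0%N :> nat then 1 - c else 0).

(** This is the reflection formula for the indicator of the ball around [a], whose reflection is the
    indicator of the ball around [oppp a]. *)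
Lemma oddmassN c N (a : 'I_(p ^ N)) :
  (forall N phi, periodic N phi ->
     rsum (mtilde c) N (fun x => phi x + phi (- x)) = (c - 1) * phi 0) ->
  oddmass c (oppp a) = - oddmass c a.
Proof.
move=> refl; have := refl N _ (@ballind_periodic _ _ N a).
have -> : (fun x : Zp => ballind N a x + ballind N a (- x)) =
          (fun x => ballind N a x + ballind N (oppp a) x).
  apply/funext => x; congr (_ + _); rewrite /ballind res_mod; congr (nat_of_bool _)%:R.
  rewrite -(res_nat pr); apply/eqP/eqP => e.
    by rewrite -[x]opprK; apply: congN; rewrite /cong -e.
  by rewrite -[a%:R]opprK; apply: congN; rewrite /cong -e.
rewrite rsumD !rsum_ballind /oddmass oppp_eq0.
rewrite /ballind -[0]/(0%:R) res_nat mod0n modn_small // eq_sym.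
by case: eqP => _ /(canRL (addKr _)) ->; rewrite ?mulr1 ?mulr0 ?addr0; ring.
Qed.

End Reflection.

(** * The integrand *)

Section Blocks.
Variables (r : nat) (J : {set 'I_r}).

Lemma jelt_enum_val (mu : 'I_#|J|) : jelt J mu = enum_val mu.
Proof.
rewrite /jelt (nth_map (enum_val mu)) -?cardE //.
by congr nat_of_ord; rewrite -enum_val_nth.
Qed.

Lemma jelt_card : jelt J #|J| = r.
Proof. by rewrite /jelt nth_default // size_map -cardE. Qed.

Lemma jelt_lt mu nu : (mu < nu)%N -> (nu <= #|J|)%N -> (jelt J mu < jelt J nu)%N.
Proof.
move=> mn; rewrite leq_eqVlt => /predU1P[nE|nJ].
  (* At the index [#|J|] the default value [r] of [jelt] exceeds every element of [J]. *)
  rewrite nE jelt_card; rewrite nE in mn.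
  by rewrite (jelt_enum_val (Ordinal mn)).
have sizeJ : size [seq nat_of_ord j | j <- enum J] = #|J| by rewrite size_map -cardE.
have srt : sorted ltn [seq nat_of_ord j | j <- enum J].
  apply: (@subseq_sorted _ _ ltn_trans _ (iota 0 r)); last exact: iota_ltn_sorted.
  by rewrite -val_enum_ord enumT /enum_mem; apply/map_subseq/filter_subseq.
apply: (sorted_ltn_nth ltn_trans r srt) => //; rewrite inE sizeJ //.
exact: ltn_trans nJ.
Qed.

Lemma jelt_le mu nu : (mu <= nu)%N -> (nu <= #|J|)%N -> (jelt J mu <= jelt J nu)%N.
Proof. by rewrite leq_eqVlt => /predU1P[->//|mn nJ]; apply/ltnW/jelt_lt. Qed.

(** No element of [J] lies strictly inside a block, so a sum over the elements of [J] up to [l]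
    depends only on the block of [l]. *)
Lemma inblock_enum_val (mu nu : 'I_#|J|) l :
  inblock J mu l -> (enum_val nu <= l)%N = (nu <= mu)%N.
Proof.
rewrite -jelt_enum_val => /andP[ml lm]; apply/idP/idP => [nl|nm].
  rewrite leqNgt; apply/negP => mn; move: nl; rewrite leqNgt => /negP; apply.
  by apply: leq_trans lm _; apply: jelt_le => //; apply: ltnW.
by apply: leq_trans ml; apply: jelt_le => //; apply: ltnW.
Qed.

Lemma inblock_self (mu : 'I_#|J|) : inblock J mu (enum_val mu).
Proof. by rewrite /inblock -jelt_enum_val leqnn jelt_lt. Qed.

Lemma inblock_uniq (mu nu : 'I_#|J|) l : inblock J mu l -> inblock J nu l -> mu = nu.
Proof.
move=> mul nul; apply/val_inj/eqP; rewrite eqn_leq.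
have /andP[ml _] := mul; have /andP[nl _] := nul.
rewrite -(inblock_enum_val _ nul) -(inblock_enum_val _ mul).
by rewrite -!jelt_enum_val ml nl.
Qed.

Variable i0 : 'I_r.
Hypotheses (i00 : i0 = 0%N :> nat) (Ji0 : i0 \in J).

Lemma jelt0 : jelt J 0 = 0%N.
Proof.
pose nu := enum_rank_in Ji0 i0.
have := jelt_le (leq0n nu) (ltnW (ltn_ord nu)).
by rewrite jelt_enum_val enum_rankK_in // i00 leqn0 => /eqP.
Qed.

(** The first block starts at 0 because [J] contains [i0], consecutive blocks are adjacent, and the
    last one ends at [r]. *)
Lemma inblock_ex l : exists mu : 'I_#|J|, inblock J mu l.
Proof.
suff ex n : (n <= #|J|)%N -> (l < jelt J n)%N -> exists mu : 'I_#|J|, inblock J mu l.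
  by apply: (ex #|J|); rewrite ?jelt_card.
elim: n => [|n IH] nJ; first by rewrite jelt0.
case: (ltnP l (jelt J n)) => [ln _|nl ln]; first exact/IH/ln/ltnW.
by exists (Ordinal nJ); rewrite /inblock nl.
Qed.

Lemma big_inblock (R : Type) (idx : R) (op : Monoid.com_law idx) (F : 'I_r -> R) :
  \big[op/idx]_l F l = \big[op/idx]_(mu < #|J|) \big[op/idx]_(l | inblock J mu l) F l.
Proof.
have [blk blkP] := choice inblock_ex.
rewrite (partition_big blk xpredT) //=; apply: eq_bigr => mu _; apply: eq_bigl => l.
by apply/eqP/idP => [<-|ml]; [exact: blkP|apply: inblock_uniq ml; apply: blkP].
Qed.

End Blocks.

(** * Continuity, parity and block structure of the integrand *)

Section Integrand.
Variables (p : nat) (pr : prime p).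
Local Notation Zp := (padicZ pr).

Section Depth.
Variables (r : nat) (s : 'I_r -> Zp) (k : 'I_r -> int) (gamma : 'I_r -> Zp).
Implicit Types x y : 'I_r -> Zp.

Definition Lfun : ('I_r -> Zp) -> Zp :=
  patch (fun=> 0) (Ldomain gamma)
    (fun x => \prod_(i < r)
      (powZp (angle (psum gamma x i)) (- s i) * omega (psum gamma x i) ^ k i)).

Lemma LfunT x : Ldomain gamma x ->
  Lfun x = \prod_(i < r)
    (powZp (angle (psum gamma x i)) (- s i) * omega (psum gamma x i) ^ k i).
Proof. by move=> xD; rewrite /Lfun /patch mem_set. Qed.

Lemma LfunF x : ~ Ldomain gamma x -> Lfun x = 0.
Proof. by move=> xD; rewrite /Lfun /patch memNset. Qed.

Lemma psum_unit x i : Ldomain gamma x -> psum gamma x i \is a GRing.unit.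
Proof. by move=> /(_ i) xD; apply/unitZpP => /inpZpP. Qed.

Lemma psum_cong N x y i : (forall j, cong N (x j) (y j)) ->
  cong N (psum gamma x i) (psum gamma y i).
Proof. by move=> e; apply: cong_sum => j _; apply: congM. Qed.

Lemma Ldomain_cong N x y : (0 < N)%N -> (forall j, cong N (x j) (y j)) ->
  Ldomain gamma x -> Ldomain gamma y.
Proof.
move=> N0 e xD i /inpZpP y0; apply: (xD i); apply/inpZpP; apply: cong_trans y0.
exact: congW N0 (psum_cong _ e).
Qed.

(** The domain is determined modulo [p] and [omega] modulo [p ^ 2], so beyond level 2 only the
    powers of [angle] still vary, and they do so continuously. *)
Lemma Lfun_ucont : ucont Lfun.
Proof.
move=> M; exists (maxn M 2) => x y e.
have N0 : (0 < maxn M 2)%N by rewrite leq_max orbT.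
have [xD|xD] := pselect (Ldomain gamma x); last first.
  rewrite !LfunF // => yD; apply: xD; apply: (Ldomain_cong N0 _ yD) => j.
  exact/cong_sym/e.
have yD := Ldomain_cong N0 e xD; rewrite !LfunT //; apply: cong_prod => i _.
have ux := psum_unit i xD; have uy := psum_unit i yD; have ei := psum_cong i e.
rewrite (omega_cont ux (congW (leq_maxr M 2) ei)); apply: congM => //.
apply: powZp_cont; [exact: angle_cong1..|].
by apply: (congW (leq_maxl M 2)); apply: angle_cont => //; rewrite leq_max orbT.
Qed.

Lemma psumN x i : psum gamma (fun j => - x j) i = - psum gamma x i.
Proof. by rewrite /psum -sumrN; apply: eq_bigr => j _; rewrite mulNr. Qed.

(** On units [angle] is even and [omega] is odd. *)
Lemma LfunN x : Lfun (fun j => - x j) = (-1) ^ (\sum_j k j) * Lfun x.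
Proof.
have [xD|xD] := pselect (Ldomain gamma x); last first.
  rewrite !LfunF ?mulr0 // => yD; apply: xD => i [z zE]; apply: (yD i).
  by exists (- z); rewrite psumN zE mulrN.
have yD : Ldomain gamma (fun j => - x j).
  move=> i [z zE]; apply: (xD i); exists (- z).
  by rewrite mulrN -zE psumN opprK.
have u1 : (-1 : Zp) \is a GRing.unit by rewrite unitrN unitr1.
rewrite !LfunT // (big_morph (fun z => (-1 : Zp) ^ z) (id1 := 1) (op1 := *%R)).
- rewrite -big_split; apply: eq_bigr => i _ /=; have ui := psum_unit i xD.
  rewrite psumN angleN // omegaN // -[- omega _]mulN1r exprzMl ?omega_unit //.
  by rewrite mulrCA.
- by move=> a b; rewrite exprzDr.
- exact: expr0z.
Qed.

End Depth.

(** All factors belonging to one block have the same base, so their exponents add up. *)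
Lemma Lfun_block (r : nat) (s : 'I_r -> Zp) (k : 'I_r -> int) (gamma : 'I_r -> Zp)
    (J : {set 'I_r}) (i0 : 'I_r) (x : 'I_r -> Zp) :
  i0 = 0%N :> nat -> i0 \in J -> (forall j, j \notin J -> x j = 0) ->
  Lfun s k gamma x =
  Lfun (fun mu : 'I_#|J| => \sum_(l | inblock J mu l) s l)
       (fun mu : 'I_#|J| => \sum_(l | inblock J mu l) k l)
       (fun mu : 'I_#|J| => gamma (enum_val mu)) (fun mu => x (enum_val mu)).
Proof.
move=> i00 Ji0 x0; set gJ := fun mu : 'I_#|J| => gamma _; set xJ := fun mu : 'I_#|J| => x _.
have psumE (mu : 'I_#|J|) l : inblock J mu l -> psum gamma x l = psum gJ xJ mu.
  move=> ml; rewrite /psum (bigID (mem J)) /= [X in _ + X]big1 ?addr0; last first.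
    by move=> j /andP[_ /x0 ->]; rewrite mul0r.
  rewrite (eq_bigl (fun j => (j \in J) && (j <= l)%N)); last by move=> j; rewrite andbC.
  rewrite big_mkcondr big_enum_val -big_mkcond /=.
  apply: eq_bigl => nu.
  exact: inblock_enum_val.
have domE : Ldomain gamma x <-> Ldomain gJ xJ.
  split=> xD; first by move=> mu; rewrite -(psumE mu _ (inblock_self mu)).
  by move=> l; have [mu ml] := inblock_ex i00 Ji0 l; rewrite (psumE _ _ ml).
have [xD|xD] := pselect (Ldomain gamma x); last by rewrite !LfunF // -domE.
have xJD : Ldomain gJ xJ by apply/domE.
rewrite !LfunT // (big_inblock i00 Ji0); apply: eq_bigr => mu _.
have u := psum_unit mu xJD.
rewrite -sumrN powZp_sum; last exact: angle_cong1.
set w := omega (psum gJ xJ mu).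
rewrite [X in _ * X](big_morph (fun z => w ^ z) (id1 := 1) (op1 := *%R)).
- by rewrite -big_split; apply: eq_bigr => l ml /=; rewrite (psumE _ _ ml).
- by move=> a b; rewrite exprzDr ?omega_unit.
- exact: expr0z.
Qed.

End Integrand.

(** * Expansion of the product measure *)

Section Expansion.
Variables (p : nat) (pr : prime p).
Local Notation Zp := (padicZ pr).

Lemma riemann_mass0 (r : nat) (m : measureZp pr) (f : ('I_r -> Zp) -> Zp) N : (0 < r)%N ->
  (forall a : 'I_(p ^ N), mass m a = 0) -> riemann m f N = 0.
Proof.
move=> r0 m0; apply: big1 => a _.
by rewrite (bigD1 (Ordinal r0)) //= m0 mul0r mulr0.
Qed.

Definition ord0p N : 'I_(p ^ N) := Ordinal (expp_gt0 pr N).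

(* The [J]-term of the expansion of [\prod_j (2 m + (1 - c) delta_0)]. *)
Lemma riemann_restrict (r : nat) (m : measureZp pr) (f : ('I_r -> Zp) -> Zp)
    (J : {set 'I_r}) (g : ('I_#|J| -> Zp) -> Zp) (i0 : 'I_r) (d : Zp) N :
  i0 \in J ->
  (forall x, (forall j, j \notin J -> x j = 0) -> f x = g (fun mu => x (enum_val mu))) ->
  \sum_(a : {ffun 'I_r -> 'I_(p ^ N)}) f (fun j => (a j : nat)%:R) *
    \prod_j (if j \in J then 2%:R * mass m (a j) else if a j == 0%N :> nat then d else 0) =
  2%:R ^+ #|J| * d ^+ (r - #|J|) * riemann m g N.
Proof.
move=> Ji0 fg.
(* Only points supported on [J] contribute; they correspond to functions on [J] extended by 0. *)
pose supp (a : {ffun 'I_r -> 'I_(p ^ N)}) := [forall j, (j \notin J) ==> (a j == ord0p N)].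
rewrite (bigID supp) /= [X in _ + X]big1 ?addr0; last first.
  move=> a /forallPn[j]; rewrite negb_imply => /andP[jJ aj].
  rewrite (bigD1 j) //= (negbTE jJ) (_ : (_ == _) = false) ?mul0r ?mulr0 //.
  exact: negbTE aj.
pose ext (b : {ffun 'I_#|J| -> 'I_(p ^ N)}) :=
  [ffun j => if j \in J then b (enum_rank_in Ji0 j) else ord0p N].
pose res (a : {ffun 'I_r -> 'I_(p ^ N)}) := [ffun mu : 'I_#|J| => a (enum_val mu)].
rewrite (reindex_onto ext res); last first.
  move=> a /forallP sa; apply/ffunP => j; rewrite !ffunE; case: ifPn => jJ.
    by rewrite enum_rankK_in.
  by have := sa j; rewrite jJ => /eqP.
have extE b mu : ext b (enum_val mu) = b mu by rewrite ffunE enum_valP enum_valK_in.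
rewrite mulr_sumr; apply: eq_big => [b|b _].
  apply/andP; split; last first.
    by apply/eqP/ffunP => mu; rewrite [LHS]ffunE extE.
  by apply/forallP => j; apply/implyP => jJ; rewrite ffunE (negbTE jJ).
rewrite fg; last by move=> j jJ; rewrite ffunE (negbTE jJ).
have -> : (fun mu => (ext b (enum_val mu) : nat)%:R) =
    (fun mu => (b mu : nat)%:R) :> (_ -> Zp).
  by apply/funext => mu; rewrite extE.
rewrite mulrCA; congr (_ * _).
rewrite (bigID (mem J)) /= -[RHS]mulrAC; congr (_ * _).
  rewrite (eq_bigr (fun j => 2%:R * mass m (ext b j))); last by move=> j ->.
  rewrite big_enum_val big_split /= prodr_const card_ord; congr (_ * _).
  by apply: eq_bigr => mu _; rewrite extE.
rewrite (eq_bigr (fun=> d)); last by move=> j jJ; rewrite ffunE (negbTE jJ).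
rewrite prodr_const; congr (d ^+ _); have -> : (r - #|J| = #|~: J|)%N.
  by rewrite -(addKn #|J| #|~: J|) cardsC card_ord.
by apply: eq_card => j; rewrite !inE.
Qed.

End Expansion.

(** * The relation between the integrals *)

Section MainIdentity.
Variables (p : nat) (pr : prime p).
Local Notation Zp := (padicZ pr).
Variables (r : nat) (k : 'I_r -> int) (gamma s : 'I_r -> Zp) (c : Zp) (i0 : 'I_r).
Hypothesis i00 : i0 = 0%N :> nat.

Definition LJ (J : {set 'I_r}) : ('I_#|J| -> Zp) -> Zp :=
  Lfun (fun mu : 'I_#|J| => \sum_(l | inblock J mu l) s l)
       (fun mu : 'I_#|J| => \sum_(l | inblock J mu l) k l)
       (fun mu : 'I_#|J| => gamma (enum_val mu)).

Definition oddsum N : Zp := \sum_(a : {ffun 'I_r -> 'I_(p ^ N)})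
  Lfun s k gamma (fun j => (a j : nat)%:R) * \prod_j oddmass c (a j).

Lemma oddsum_expand N :
  oddsum N = 2%:R ^+ r * riemann (mtilde c) (Lfun s k gamma) N +
    \sum_(J : {set 'I_r} | (J \proper [set: 'I_r]) && (i0 \in J))
      2%:R ^+ #|J| * (1 - c) ^+ (r - #|J|) * riemann (mtilde c) (@LJ J) N.
Proof.
pose f := Lfun s k gamma.
pose term (J : {set 'I_r}) := \sum_(a : {ffun 'I_r -> 'I_(p ^ N)})
  f (fun j => (a j : nat)%:R) * \prod_j (if j \in J then 2%:R * mass (mtilde c) (a j)
     else if a j == 0%N :> nat then 1 - c else 0).
have -> : oddsum N = \sum_(J : {set 'I_r}) term J.
  rewrite exchange_big; apply: eq_bigr => a _.
  by rewrite -mulr_sumr; congr (_ * _); apply: bigA_distr.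
rewrite (bigD1 [set: 'I_r]%SET) //=; congr (_ + _).
  rewrite mulr_sumr; apply: eq_bigr => a _.
  rewrite (eq_bigr (fun j => 2%:R * mass (mtilde c) (a j))); last first.
    by move=> j _; rewrite inE.
  by rewrite big_split /= prodr_const card_ord mulrCA.
(* When [i0] is not in [J], a nonzero first coordinate kills the Dirac factor, while a zero one
   makes the first partial sum 0 and puts the point outside the domain. *)
rewrite (bigID (fun J : {set 'I_r} => i0 \in J)) /= [X in _ + X]big1 ?addr0; last first.
  move=> J /andP[_ Ji0]; apply: big1 => a _; have [a0|a0] := eqVneq (a i0 : nat) 0%N.
    rewrite /f LfunF ?mul0r // => /(_ i0); apply; exists 0.
    rewrite mulr0; apply: big1 => j; rewrite i00 leqn0 => /eqP j0.
    have -> : j = i0 by apply/val_inj; rewrite /= i00.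
    by rewrite a0 mul0r.
  by rewrite (bigD1 i0) //= (negbTE Ji0) (negbTE a0) mul0r mulr0.
apply: eq_big => [J|J /andP[_ Ji0]]; first by rewrite properT.
apply: (riemann_restrict (g := @LJ J) _ _ _ Ji0) => x x0.
exact: (Lfun_block s k gamma i00 Ji0 x0).
Qed.

Hypothesis hk : (\sum_j k j != r%:Z %[mod 2])%Z.

(** The total sign under reflection: [(-1) ^+ r] from the [r] odd masses, the other factor from the
    integrand. *)
Lemma sign_odd : (-1 : Zp) ^+ r * (-1) ^ (\sum_j k j) = -1.
Proof.
have u1 : (-1 : Zp) \is a GRing.unit by rewrite unitrN unitr1.
have [z zE] : exists z : int, r%:Z + \sum_j k j = 2 * z + 1.
  exists ((r%:Z + \sum_j k j) %/ 2)%Z; move: hk; lia.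
rewrite -[_ ^+ r]/((-1) ^ r%:Z) -exprzDr // zE exprzDr // -exprz_exp.
by rewrite -[(-1) ^ 2]/((-1) * (-1)) mulrNN mul1r exp1rz mul1r.
Qed.

(** Reindexing by [oppp] shows that the sum is congruent to its opposite. Equality may fail, since
    [oppp] represents the opposite only modulo [p ^ K]. *)
Lemma oddsum_small M :
  (forall N phi, periodic N phi ->
     rsum (mtilde c) N (fun x => phi x + phi (- x)) = (c - 1) * phi 0) ->
  exists N, forall K, (N <= K)%N -> cong M (2%:R * oddsum K) 0.
Proof.
move=> refl; have [N NP] := Lfun_ucont s k gamma M; exists N => K NK.
suff : cong M (oddsum K) (- oddsum K).
  move=> /(congD (congxx M (oddsum K))); rewrite subrr.
  by have -> : oddsum K + oddsum K = 2%:R * oddsum K by ring.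
pose flip (a : {ffun 'I_r -> 'I_(p ^ K)}) := [ffun j => oppp pr (a j)].
have flipK : involutive flip by move=> a; apply/ffunP => j; rewrite !ffunE opppK.
rewrite {1}/oddsum (reindex_inj (inv_inj flipK)) /= -mulN1r mulr_sumr.
apply: cong_sum => a _.
rewrite (eq_bigr (fun j => -1 * oddmass c (a j))); last first.
  by move=> j _; rewrite ffunE oddmassN // mulN1r.
rewrite big_split /= prodr_const card_ord -[X in cong _ _ (X * _)]sign_odd.
set P := \prod_j _; set f := Lfun s k gamma.
have -> : (-1) ^+ r * (-1) ^ (\sum_j k j) * (f (fun j => (a j : nat)%:R) * P) =
    (-1) ^ (\sum_j k j) * f (fun j => (a j : nat)%:R) * ((-1) ^+ r * P) by ring.
apply: congM => //; rewrite /f -LfunN; apply: NP => j.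
by apply: (congW NK); rewrite ffunE; apply: cong_oppp.
Qed.

Lemma Lp_relation :
  (forall N phi, periodic N phi ->
     rsum (mtilde c) N (fun x => phi x + phi (- x)) = (c - 1) * phi 0) ->
  2%:R ^+ r * integralZp (mtilde c) (Lfun s k gamma) +
    \sum_(J : {set 'I_r} | (J \proper [set: 'I_r]) && (i0 \in J))
      2%:R ^+ #|J| * (1 - c) ^+ (r - #|J|) * integralZp (mtilde c) (@LJ J) = 0.
Proof.
(* The factor 2 matches [oddsum_small]; it is cancelled exactly, after the passage to the limit. *)
move=> refl; set X := _ + _; apply: (@mulIn _ pr 2) => //; rewrite mulr0.
apply: cong_eq => M; have [N1 N1P] := oddsum_small M refl.
have [N2 N2P] := riemann_cvg (mtilde c) (Lfun_ucont s k gamma) M.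
have LJc (J : {set 'I_r}) : exists N, forall K, (N <= K)%N ->
  cong M (riemann (mtilde c) (@LJ J) K) (integralZp (mtilde c) (@LJ J)).
  exact/riemann_cvg/Lfun_ucont.
have [N3 N3P] := choice LJc.
pose K := maxn (maxn N1 N2) (\max_J N3 J).
have K1 : (N1 <= K)%N by rewrite /K !leq_max leqnn.
have K2 : (N2 <= K)%N by rewrite /K !leq_max leqnn orbT.
have K3 J : (N3 J <= K)%N by rewrite /K leq_max leq_bigmax orbT.
apply: cong_trans (N1P K K1); apply: congM => //; apply: cong_sym.
rewrite oddsum_expand; apply: congD; first by apply: congM => //; apply: N2P.
by apply: cong_sum => J _; apply: congM => //; apply: N3P.
Qed.

End MainIdentity.

Theorem theorem2p15 (p : nat) (pr : prime p) (r : nat) (hr : (1 < r)%N)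
  (k : 'I_r -> int) (hk : (\sum_j k j != r%:Z %[mod 2])%Z)
  (gamma : 'I_r -> padicZ pr)
  (hgamma : forall j : 'I_r, (0 < j)%N -> inpZp (gamma j))
  (c : padicZ pr) (hc : c \is a GRing.unit) (s : 'I_r -> padicZ pr) :
  (Lp s k gamma c)%:Qp =
  - \sum_(J : {set 'I_r} | (J \proper [set: 'I_r]) && (Ordinal (ltnW hr) \in J))
      ((1 - c)%:Qp / 2) ^+ (r - #|J|) *
      (Lp (fun mu : 'I_#|J| => \sum_(l | inblock J mu l) s l)
          (fun mu : 'I_#|J| => \sum_(l | inblock J mu l) k l)
          (fun mu : 'I_#|J| => gamma (enum_val mu)) c)%:Qp
  :> Qp pr.
Proof.
set i0 := Ordinal _.
(* In the first case all masses are 0, so every L-value of positive depth vanishes, on both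
   sides. *)
have [m0|refl] := mtilde_dichotomy hc.
  have Lp0 n (s' : 'I_n -> padicZ pr) k' gamma' : (0 < n)%N -> Lp s' k' gamma' c = 0.
    move=> n0; apply: integralZp0 => N; apply: riemann_mass0 => // a.
    by rewrite -rsum_ballind m0 //; apply: ballind_periodic.
  rewrite Lp0 ?(ltnW hr) // big1 ?oppr0 // => J /andP[_ Ji0].
  by rewrite Lp0 ?mulr0 //; apply/card_gt0P; exists i0.
have two0 : (2 : Qp pr) != 0.
  by rewrite -(rmorph_nat (@FracField.tofrac _)) tofrac_eq0 natZp_neq0.
have := Lp_relation gamma s (i0 := i0) erefl hk refl.
move=> /(congr1 (fun x => x%:Qp)); rewrite rmorph0 rmorphD rmorphM rmorphXn rmorph_nat /=.
move=> /eqP; rewrite addr_eq0 => /eqP e.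
(* Over the fraction field the statement is compared with [Lp_relation] after multiplication by
   [2 ^+ r], of which [r - #|J|] factors clear the denominators of the [J]-term. *)
apply: (mulfI (expf_neq0 r two0)); rewrite e mulrN; congr (- _).
rewrite rmorph_sum mulr_sumr; apply: eq_bigr => J _.
rewrite !rmorphM /= !rmorphXn rmorph_nat /= mulrA; congr (_ * _).
have -> : (2 : Qp pr) ^+ r = 2 ^+ #|J| * 2 ^+ (r - #|J|).
  by rewrite -exprD subnKC // -[X in (_ <= X)%N]card_ord max_card.
by rewrite -mulrA -exprMn mulrCA divff ?mulr1.
Qed.
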